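(* Let $G\rightrightarrows Q$ be a Lie groupoid and let $L_d:G_2\to\mathbb{R}$ be a discrete second-order Lagrangian. For every section $Z=(X,Y)$ of the Lie algebroid $A(\mathcal{P}^{\alpha}G)$, with associated left- and right-invariant vector fields $\overleftarrow{Z}(g,h,r)=(0,\overleftarrow{X}(h),Y(r))$ and $\overrightarrow{Z}(g,h,r)=(-Y(g),\overrightarrow{X}(h),0)$, the discrete second-order Euler-Lagrange equations associated with $L_d$ are $$0=\ell_{g_k}^{*}\big(D_1L_d(g_k,g_{k+1})+D_2L_d(g_{k-1},g_k)\big)+(r_{g_{k+1}}\circ i)^{*}\big(D_1L_d(g_{k+1},g_{k+2})+D_2L_d(g_k,g_{k+1})\big),$$ for $k=2,\ldots,N-2$.
   Context: A Lie groupoid $G\rightrightarrows Q$ has source $\alpha$, target $\beta$, identity section $\epsilon$, inversion $i$, and multiplication $gh$ defined on $G_2=\{(g,h)\in G\times G\mid\beta(g)=\alpha(h)\}$. Left and right translations are $\ell_g(h)=gh$ and $r_g(h)=hg$. The Lie algebroid $AG\to Q$ has fibre $A_qG=\ker T_{\epsilon(q)}\alpha$; a section $X$ determines the left-invariant vector field $\overleftarrow{X}(g)=T_{\epsilon(\beta(g))}\ell_g(X(\beta(g)))$ and the right-invariant vector field $\overrightarrow{X}(g)=-T_{\epsilon(\alpha(g))}(r_g\circ i)(X(\alpha(g)))$. A discrete second-order Lagrangian is a smooth function $L_d:G_2\to\mathbb{R}$. The prolongation of $G$ over $\alpha$ is the Lie groupoid $\mathcal{P}^{\alpha}G=\{(g,h,r)\in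 G\times G\times G\mid \alpha(g)=\alpha(h),\ \beta(h)=\alpha(r)\}$ over $G$, with source $(g,h,r)\mapsto g$, target $(g,h,r)\mapsto r$, and multiplication $(g,h,r)(r,h',s)=(g,hh',s)$. Its Lie algebroid $A(\mathcal{P}^{\alpha}G)\to G$ has fibre at $g$ equal to $\{(a,Y_g)\in A_{\alpha(g)}G\times T_gG\mid T\alpha(Y_g)=T\beta(a)\}$. Sections are written $Z=(X,Y)$, meaning $Z(g)=(X(\alpha(g)),Y(g))$ with $X\in\Gamma(AG)$ and $Y$ a vector field on $G$ such that $T\beta(X)=T\alpha(Y)$. The cotangent groupoid $T^*(\mathcal{P}^{\alpha}G)\rightrightarrows A^*(\mathcal{P}^{\alpha}G)$ is a symplectic groupoid with the canonical symplectic form. For $\mu\in T^*_{(g,h,r)}(\mathcal{P}^{\alpha}G)$ its source $\tilde\alpha(\mu)\in A^*_g(\mathcal{P}^{\alpha}G)$ and target $\tilde\beta(\mu)\in A^*_r(\mathcal{P}^{\alpha}G)$ satisfy $\langle\tilde\alpha(\mu),Z(g)\rangle=\langle\mu,\overrightarrow{Z}(g,h,r)\rangle$ and $\langle\tilde\beta(\mu),Z(r)\rangle=\langle\mu,\overleftarrow{Z}(g,h,r)\rangle$ for all sections $Z$ of $A(\mathcal{P}^{\alpha}G)$. Let $i_{G_2}:G_2\hookrightarrow\mathcal{P}^{\alpha}G$, $i_{G_2}(g,h)=(g,g,h)$. The Lagrangian submanifold generated by $L_d$ is $\Sigma_{L_d}=\{\mu\in T^*(\mathcal{P}^{\alpha}G)\mid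 i_{G_2}^*\mu=dL_d\}$ (covectors based at points of $i_{G_2}(G_2)$). Let $g_1,\ldots,g_N\in G$ with $(g_k,g_{k+1})\in G_2$ for $k=1,\ldots,N-1$. A sequence $\gamma_{(g_1,g_2)},\ldots,\gamma_{(g_{N-1},g_N)}$ with $\gamma_{(g_k,g_{k+1})}\in T^*_{(g_k,g_k,g_{k+1})}(\mathcal{P}^{\alpha}G)$ satisfies the discrete second-order dynamics on $\Sigma_{L_d}$ if all its elements lie in $\Sigma_{L_d}$ and $\tilde\alpha(\gamma_{(g_k,g_{k+1})})=\tilde\beta(\gamma_{(g_{k-1},g_k)})$ for $k=2,\ldots,N-1$; that is, $\langle\gamma_{(g_{k-1},g_k)},\overleftarrow{Z}(g_{k-1},g_{k-1},g_k)\rangle=\langle\gamma_{(g_k,g_{k+1})},\overrightarrow{Z}(g_k,g_k,g_{k+1})\rangle$ for every section $Z$ of $A(\mathcal{P}^{\alpha}G)$. The discrete second-order Euler-Lagrange equations associated with $L_d$ are understood here as the equations on $g_1,\ldots,g_N$ derived from this dynamics by taking sections $Z$ in the last relation and eliminating the covectors. $D_1L_d(g,h)\in T_g^*G$ and $D_2L_d(g,h)\in T_h^*G$ are the partial differentials of $L_d$ in the first and second argument (of any local smooth extension to $G\times G$; the displayed expression does not depend on the extension). The displayed equation is an equality in $A^*_{\beta(g_k)}G$: the pull-backs are taken at $\epsilon(\beta(g_k))=\epsilon(\alpha(g_{k+1}))$ and evaluated on vectors of $A_{\beta(g_k)}G$. *)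

(* Defs.v *)
From HB Require Import structures.
From mathcomp Require Import all_boot all_order all_algebra.
From mathcomp Require Import all_classical all_reals all_analysis.
Set Implicit Arguments.
Unset Strict Implicit.
Unset Printing Implicit Defensive.
Import Order.TTheory GRing.Theory Num.Theory.
Import numFieldNormedType.Exports.
Local Open Scope classical_set_scope.
Local Open Scope ring_scope.

(* Used with [U] open and [V] finite-dimensional: asking for all directional
   derivatives then amounts to asking for all partial derivatives. *)
Fixpoint Ck (R : realType) (V W : normedModType R) (k : nat) (U : set V)
    (f : V -> W) : Prop :=
  if k is k'.+1 then
    (forall x, U x -> differentiable f x) /\
    (forall v, Ck k' U (fun x => 'D_v f x))
  else forall x, U x -> {for x, continuous f}.

Definition smooth_on (R : realType) (V W : normedModType R) (U : set V)
  (f : V -> W) : Prop := forall k, Ck k U f.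

Section CkLemmas.
Variable R : realType.
Implicit Types V W : normedModType R.

Lemma near_differentiable V W (f g : V -> W) x :
  (\forall y \near x, f y = g y) -> differentiable f x -> differentiable g x.
Proof.
move=> fg df.
have fgx : f x = g x by exact: nbhs_singleton fg.
have gE : g \o shift x = cst (g x) + 'd f x +o_ 0 id.
  apply/eqaddoP => e e0.
  have /eqaddoP/(_ e e0) H := diff_locally df.
  have fg0 : \forall h \near (0 : V), f (h + x) = g (h + x).
    by move: fg; rewrite (near_shift 0) /= subr0.
  apply: filterS2 H fg0 => h; rewrite !fctE /= => H fgh.
  by move: H; rewrite fgx fgh.
apply/diff_locallyP.
have c : continuous ('d f x) by exact: diff_continuous.
by rewrite (diff_unique c gE).
Qed.

Lemma Ck_eq V W k (U : set V) (f g : V -> W) : open U ->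
  (forall x, U x -> f x = g x) -> Ck k U f -> Ck k U g.
Proof.
move=> oU; elim: k f g => [|k IH] f g fg /=.
  move=> cf x Ux; have := cf x Ux.
  rewrite /prop_for /continuous_at -fg//; apply: cvg_trans.
  apply: near_eq_cvg; near=> y; apply: fg; near: y; exact: open_nbhs_nbhs.
move=> [df Df]; split.
  move=> x Ux; apply: near_differentiable (df x Ux).
  by near=> y; apply: fg; near: y; exact: open_nbhs_nbhs.
move=> v; apply: IH (Df v) => x Ux; apply: near_eq_derive.
by near=> y; apply: fg; near: y; exact: open_nbhs_nbhs.
Unshelve. all: by end_near. Qed.

Lemma Ck_pair V W W' k (U : set V) (f : V -> W) (g : V -> W') : open U ->
  Ck k U f -> Ck k U g -> Ck k U (fun x => (f x, g x)).
Proof.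
move=> oU; elim: k f g => [|k IH] f g /=.
  by move=> cf cg x Ux; apply: cvg_pair; [exact: cf|exact: cg].
move=> [df Df] [dg Dg]; split=> [x Ux|v].
  by apply: differentiable_pair; [exact: df|exact: dg].
apply: (Ck_eq oU) (IH _ _ (Df v) (Dg v)) => x Ux.
have dfx := df x Ux; have dgx := dg x Ux.
rewrite (deriveE v dfx) (deriveE v dgx) deriveE ?diff_pair//.
exact: differentiable_pair.
Qed.

Lemma Ck_fst V V' W k (U : set V) (U' : set V') (f : V -> W) :
  Ck k U f -> Ck k (U `*` U') (f \o fst).
Proof.
elim: k f => [|k IH] f /=.
  move=> cf x [Ux _]; apply: continuous_comp; [exact: cvg_fst|exact: cf].
move=> [df Df]; split=> [x [Ux _]|v]; last exact: IH (Df v.1).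
apply: differentiable_comp; last exact: df.
by apply: linear_differentiable => z; exact: cvg_fst.
Qed.

Lemma Ck_snd V V' W k (U : set V) (U' : set V') (f : V' -> W) :
  Ck k U' f -> Ck k (U `*` U') (f \o snd).
Proof.
elim: k f => [|k IH] f /=.
  move=> cf x [_ Ux]; apply: continuous_comp; [exact: cvg_snd|exact: cf].
move=> [df Df]; split=> [x [_ Ux]|v]; last exact: IH (Df v.2).
apply: differentiable_comp; last exact: df.
by apply: linear_differentiable => z; exact: cvg_snd.
Qed.
End CkLemmas.

Record chart (R : realType) (E : normedModType R) (M : topologicalType) :=
  Chart {
    cdom : set M;
    cimg : set E;
    cphi : M -> E;
    cpsi : E -> M;
    cdom_open : open cdom;
    cimg_open : open cimg;
    cphi_img : forall p, cdom p -> cimg (cphi p);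
    cpsi_dom : forall x, cimg x -> cdom (cpsi x);
    cphiK : forall p, cdom p -> cpsi (cphi p) = p;
    cpsiK : forall x, cimg x -> cphi (cpsi x) = x;
    cphi_continuous : forall p, cdom p -> {for p, continuous cphi};
    cpsi_continuous : forall x, cimg x -> {for x, continuous cpsi} }.

(* A space with a smooth atlas modelled on [E]; the charts of the atlas are
   indexed by the points, the one of index [p] being defined around [p].
   Every smooth structure is given by an atlas of this kind.
   The tangent space at [p] is [E]: a vector is represented by its components
   in the chart of index [p]. *)
Record atlas_space (R : realType) (E : normedModType R) := AtlasSpace {
  points :> topologicalType;
  chart_at : points -> chart E points;
  chart_at_dom : forall p, cdom (chart_at p) p;
  chart_compat : forall p q,
    smooth_on (cimg (chart_at p) `&` cpsi (chart_at p) @^-1` cdom (chart_at q))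
      (cphi (chart_at q) \o cpsi (chart_at p)) }.

Definition is_manifold (R : realType) (E : normedModType R)
    (M : atlas_space E) : Prop :=
  hausdorff_space M /\ @second_countable M.

Section Products.
Variable R : realType.

Section ProdChart.
Variables (E F : normedModType R) (M N : topologicalType).
Variables (c : chart E M) (d : chart F N).

Let pphi (z : M * N) : E * F := (cphi c z.1, cphi d z.2).
Let ppsi (z : E * F) : M * N := (cpsi c z.1, cpsi d z.2).

Lemma open_prod (S T : topologicalType) (A : set S) (B : set T) :
  open A -> open B -> open (A `*` B).
Proof.
move=> oA oB; rewrite openE => -[x y] [/= Ax By]; exists (A, B) => //=.
by split; apply: open_nbhs_nbhs.
Qed.

Lemma pphi_continuous z : (cdom c `*` cdom d) z -> {for z, continuous pphi}.
Proof.
move=> [cz dz]; apply: cvg_pair.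
  by apply: continuous_comp; [exact: cvg_fst|exact: cphi_continuous].
by apply: continuous_comp; [exact: cvg_snd|exact: cphi_continuous].
Qed.

Lemma ppsi_continuous z : (cimg c `*` cimg d) z -> {for z, continuous ppsi}.
Proof.
move=> [cz dz]; apply: cvg_pair.
  by apply: continuous_comp; [exact: cvg_fst|exact: cpsi_continuous].
by apply: continuous_comp; [exact: cvg_snd|exact: cpsi_continuous].
Qed.

Definition prod_chart : chart (E * F)%type (M * N)%type.
Proof.
refine (@Chart R (E * F)%type (M * N)%type (cdom c `*` cdom d)
  (cimg c `*` cimg d) pphi ppsi _ _ _ _ _ _ pphi_continuous ppsi_continuous).
- by apply: open_prod; exact: cdom_open.
- by apply: open_prod; exact: cimg_open.
- by move=> z [? ?]; split; exact: cphi_img.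
- by move=> z [? ?]; split; exact: cpsi_dom.
- by move=> [x y] [? ?]; rewrite /ppsi /pphi /= !cphiK.
- by move=> [x y] [? ?]; rewrite /ppsi /pphi /= !cpsiK.
Defined.
End ProdChart.

Lemma chart_overlap_open (E F : normedModType R) (M : topologicalType)
  (c : chart E M) (d : chart F M) : open (cimg c `&` cpsi c @^-1` cdom d).
Proof.
rewrite openE => x [cx dx]; apply: filterI.
  by apply: open_nbhs_nbhs; split=> //; exact: cimg_open.
apply: (cpsi_continuous cx); apply: open_nbhs_nbhs; split=> //.
exact: cdom_open.
Qed.

Variables (E F : normedModType R) (M : atlas_space E) (N : atlas_space F).

Lemma prod_compat (p q : M * N) :
  let c := prod_chart (chart_at p.1) (chart_at p.2) in
  let d := prod_chart (chart_at q.1) (chart_at q.2) in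
  smooth_on (cimg c `&` cpsi c @^-1` cdom d) (cphi d \o cpsi c).
Proof.
move=> c d k.
have -> : cimg c `&` cpsi c @^-1` cdom d =
    (cimg (chart_at p.1) `&` cpsi (chart_at p.1) @^-1` cdom (chart_at q.1)) `*`
    (cimg (chart_at p.2) `&` cpsi (chart_at p.2) @^-1` cdom (chart_at q.2)).
  by apply/seteqP; split=> -[x y] /= [[? ?] [? ?]].
apply: Ck_pair; first by apply: open_prod; exact: chart_overlap_open.
  exact/(@Ck_fst _ _ _ _ _ _ _
    (cphi (chart_at q.1) \o cpsi (chart_at p.1)))/chart_compat.
exact/(@Ck_snd _ _ _ _ _ _ _
    (cphi (chart_at q.2) \o cpsi (chart_at p.2)))/chart_compat.
Qed.

Definition prod_space : atlas_space (E * F)%type.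
Proof.
refine (@AtlasSpace R (E * F)%type (M * N)%type
  (fun p => prod_chart (chart_at p.1) (chart_at p.2)) _ prod_compat).
by move=> p; split; exact: chart_at_dom.
Defined.
End Products.

Section FlatSpace.
Variables (R : realType) (E : normedModType R).

Definition id_chart : chart E E.
Proof.
refine (@Chart R E E setT setT id id openT openT _ _ _ _ _ _) => //;
  by move=> x _; exact: cvg_id.
Defined.

Lemma id_compat :
  smooth_on (cimg id_chart `&` cpsi id_chart @^-1` cdom id_chart)
    (cphi id_chart \o cpsi id_chart).
Proof.
move=> [|k] /=; first by move=> x _; exact: cvg_id.
split=> [x _|v].
  by apply: (@linear_differentiable _ _ _ idfun) => z; exact: cvg_id.
have -> : (fun x : E => 'D_v (id \o id) x) = cst v.
  by apply/funext => x; rewrite (@derive_id _ _ x v).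
elim: k v => [|k IH] v /=; first by move=> x _; exact: cst_continuous.
split=> [x _|w]; first exact: differentiable_cst.
have -> : (fun x : E => 'D_w (cst v) x) = cst (0 : E).
  by apply/funext => x; rewrite derive_cst.
exact: IH.
Qed.

Definition flat_space : atlas_space E :=
  @AtlasSpace R E E (fun=> id_chart) (fun=> I) (fun _ _ => id_compat).
End FlatSpace.

Section SmoothMaps.
Variables (R : realType) (E F : normedModType R).
Variables (M : atlas_space E) (N : atlas_space F).

Definition local_rep (f : M -> N) (p : M) : E -> F :=
  cphi (chart_at (f p)) \o f \o cpsi (chart_at p).

(* Smoothness on a neighbourhood of [p]. *)
Definition smooth_at (f : M -> N) (p : M) : Prop :=
  exists U : set E, [/\ open_nbhs (cphi (chart_at p) p) U,
    U `<=` cimg (chart_at p),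
    U `<=` [set x | cdom (chart_at (f p)) (f (cpsi (chart_at p) x))] &
    smooth_on U (local_rep f p)].

Definition smooth (f : M -> N) : Prop := forall p, smooth_at f p.

(* T_p f : T_p M -> T_(f p) N *)
Definition tmap (f : M -> N) (p : M) : E -> F :=
  'd (local_rep f p) (cphi (chart_at p) p).

Definition submersion (f : M -> N) : Prop :=
  smooth f /\ forall p w, exists v, tmap f p v = w.

(* Maps defined on an embedded submanifold [S] of [M] are given by total
   functions whose values outside [S] are irrelevant. *)
Definition local_extension (S : set M) (f : M -> N) (p : M) (f' : M -> N) :
    Prop :=
  smooth_at f' p /\ \forall q \near p, S q -> f' q = f q.

Definition smooth_along (S : set M) (f : M -> N) : Prop :=
  forall p, S p -> exists f', local_extension S f p f'.

(* The tangent map at [p] of [f : S -> N]. On vectors tangent to [S] it does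
   not depend on the extension chosen by [xget]; on other vectors it is
   meaningless. *)
Definition tmap_along (S : set M) (f : M -> N) (p : M) : E -> F :=
  tmap (xget f [set f' | local_extension S f p f']) p.
End SmoothMaps.

(* A vector of T_p M expressed in the chart of index [c]. *)
Definition components (R : realType) (E : normedModType R) (M : atlas_space E)
    (c p : M) : E -> E :=
  'd (cphi (chart_at c) \o cpsi (chart_at p)) (cphi (chart_at p) p).

(* Smoothness of a vector field [X q : T_(f q) M] along [f : N -> M]. *)
Definition smooth_field_along (R : realType) (E F : normedModType R)
    (M : atlas_space E) (N : atlas_space F) (f : N -> M) (X : N -> E) : Prop :=
  forall q, smooth_at (N := flat_space E)
    (fun q' => components (f q) (f q') (X q')) q.

Definition smooth_field (R : realType) (E : normedModType R)
    (M : atlas_space E) (X : M -> E) : Prop :=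
  smooth_field_along (@id M) X.

Record groupoid_ops (M B : Type) := GroupoidOps {
  src : M -> B;
  tgt : M -> B;
  unit_at : B -> M;
  ginv : M -> M;
  gmul : M -> M -> M }.

Section InvariantFields.
Variables (R : realType) (E F : normedModType R).
Variables (M : atlas_space E) (B : atlas_space F).
(* A groupoid whose arrows form the subset [D] of [M]. *)
Variables (D : set M) (Gm : groupoid_ops M B).

(* T_(eps (tgt g)) l_g, l_g being defined on the source fibre over tgt g *)
Definition tleft (g : M) : E -> E :=
  tmap_along (N := M) [set h | D h /\ src Gm h = tgt Gm g]
    (gmul Gm g) (unit_at Gm (tgt Gm g)).

(* T_(eps (src g)) (r_g o i), r_g o i being defined on the source fibre over
   src g *)
Definition tright_inv (g : M) : E -> E :=
  tmap_along (N := M) [set h | D h /\ src Gm h = src Gm g]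
    (fun h => gmul Gm (ginv Gm h) g) (unit_at Gm (src Gm g)).

Definition left_field (X : B -> E) (g : M) : E := tleft g (X (tgt Gm g)).
Definition right_field (X : B -> E) (g : M) : E := - tright_inv g (X (src Gm g)).
End InvariantFields.

Definition composable (M B : Type) (Gm : groupoid_ops M B) : set (M * M) :=
  [set z | tgt Gm z.1 = src Gm z.2].

Record lie_groupoid (R : realType) (n m : nat) := LieGroupoid {
  arrows : atlas_space 'rV[R]_n;
  base : atlas_space 'rV[R]_m;
  ops :> groupoid_ops arrows base;
  arrows_manifold : is_manifold arrows;
  base_manifold : is_manifold base;
  src_submersion : submersion (src ops);
  tgt_submersion : submersion (tgt ops);
  unit_smooth : smooth (unit_at ops);
  ginv_smooth : smooth (ginv ops);
  gmul_smooth : smooth_along (M := prod_space arrows arrows)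
    (composable ops) (fun z => gmul ops z.1 z.2);
  src_unit : forall q, src ops (unit_at ops q) = q;
  tgt_unit : forall q, tgt ops (unit_at ops q) = q;
  src_mul : forall g h, tgt ops g = src ops h ->
    src ops (gmul ops g h) = src ops g;
  tgt_mul : forall g h, tgt ops g = src ops h ->
    tgt ops (gmul ops g h) = tgt ops h;
  gmulA : forall g h r, tgt ops g = src ops h -> tgt ops h = src ops r ->
    gmul ops g (gmul ops h r) = gmul ops (gmul ops g h) r;
  unit_mul : forall g, gmul ops (unit_at ops (src ops g)) g = g;
  mul_unit : forall g, gmul ops g (unit_at ops (tgt ops g)) = g;
  src_inv : forall g, src ops (ginv ops g) = tgt ops g;
  tgt_inv : forall g, tgt ops (ginv ops g) = src ops g;
  mul_inv : forall g, gmul ops g (ginv ops g) = unit_at ops (src ops g);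
  inv_mul : forall g, gmul ops (ginv ops g) g = unit_at ops (tgt ops g) }.

Section SecondOrder.
Variables (R : realType) (n m : nat) (G : lie_groupoid R n m).
Local Notation E := 'rV[R]_n.
Local Notation A := (arrows G).
Local Notation A2 := (prod_space A A).
Local Notation A3 := (prod_space (prod_space A A) A).

(* The fibre A_qG, as a subspace of T_(eps q) G *)
Definition algebroid (q : base G) : set E :=
  [set a | tmap (src G) (unit_at G q) a = 0].

Definition algebroid_section (X : base G -> E) : Prop :=
  smooth_field_along (unit_at G) X /\ forall q, algebroid q (X q).

Definition lfield (X : base G -> E) : A -> E := left_field setT G X.
Definition rfield (X : base G -> E) : A -> E := right_field setT G X.

Definition G2 : set A2 := composable G.

Definition tangent_G2 (z : A2) : set (E * E) :=
  [set u | tmap (tgt G) z.1 u.1 = tmap (src G) z.2 u.2].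

(* The prolongation P^alpha G, as an embedded submanifold of G x G x G; the
   triple (g, h, r) is ((g, h), r). *)
Definition prolongation : set A3 :=
  [set z | src G z.1.1 = src G z.1.2 /\ tgt G z.1.2 = src G z.2].

Definition tangent_prolongation (z : A3) : set (E * E * E) :=
  [set u | tmap (src G) z.1.1 u.1.1 = tmap (src G) z.1.2 u.1.2 /\
           tmap (tgt G) z.1.2 u.1.2 = tmap (src G) z.2 u.2].

Definition prolongation_ops : groupoid_ops A3 A :=
  @GroupoidOps A3 A
    (fun z => z.1.1)
    (fun z => z.2)
    (fun g => (g, unit_at G (src G g), g))
    (fun z => (z.2, ginv G z.1.2, z.1.1))
    (fun z w => (z.1.1, gmul G z.1.2 w.1.2, w.2)).

(* The pair (X, Y) as a section of A(P^alpha G): the fibre of A(P^alpha G) at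
   [g] is the kernel of the differential of the source at the unit
   (g, eps (src g), g), that is the set of the vectors (0, a, Y) tangent to the
   prolongation. *)
Definition prol_section (X : base G -> E) (Y : A -> E) : A -> E * E * E :=
  fun g => (0, X (src G g), Y g).

Definition is_prol_section (X : base G -> E) (Y : A -> E) : Prop :=
  [/\ algebroid_section X, smooth_field Y &
      forall g, tmap (tgt G) (unit_at G (src G g)) (X (src G g)) =
                tmap (src G) g (Y g)].

Definition prol_lfield (X : base G -> E) (Y : A -> E) : A3 -> E * E * E :=
  left_field prolongation prolongation_ops (prol_section X Y).
Definition prol_rfield (X : base G -> E) (Y : A -> E) : A3 -> E * E * E :=
  right_field prolongation prolongation_ops (prol_section X Y).

(* Covectors of the prolongation at [z]: linear forms on its tangent space; the
   values outside the tangent space are irrelevant. *)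
Definition covector (z : A3) (mu : E * E * E -> R) : Prop :=
  forall (c : R) u v, tangent_prolongation z u -> tangent_prolongation z v ->
    mu (c *: u + v) = c * mu u + mu v.

Definition incl_G2 (z : A2) : A3 := (z.1, z.1, z.2).

Definition discrete_lagrangian (L : A2 -> R^o) : Prop :=
  smooth_along (N := flat_space R^o) G2 L.

(* [mu], based at [incl_G2 z], belongs to Sigma_L *)
Definition in_Sigma (L : A2 -> R^o) (z : A2) (mu : E * E * E -> R) : Prop :=
  covector (incl_G2 z) mu /\
  forall u, tangent_G2 z u ->
    mu (tmap (N := A3) incl_G2 z u) =
    tmap_along (N := flat_space R^o) G2 L z u.

(* [gam k] is the covector at (g_k, g_k, g_(k+1)), for 1 <= k <= N - 1. *)
Definition second_order_dynamics (L : A2 -> R^o) (N : nat) (g : nat -> A)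
    (gam : nat -> E * E * E -> R) : Prop :=
  (forall k, (1 <= k < N)%N -> in_Sigma L (g k, g k.+1) (gam k)) /\
  (forall k, (2 <= k < N)%N -> forall X Y, is_prol_section X Y ->
     gam k.-1 (prol_lfield X Y (g k.-1, g k.-1, g k)) =
     gam k (prol_rfield X Y (g k, g k, g k.+1))).

(* Partial differentials of a function on G x G *)
Definition D1 (f : A2 -> R^o) (g h : A) (v : E) : R :=
  tmap (N := flat_space R^o) f (g, h) (v, 0).
Definition D2 (f : A2 -> R^o) (g h : A) (w : E) : R :=
  tmap (N := flat_space R^o) f (g, h) (0, w).

End SecondOrder.

(* Main.v *)
From HB Require Import structures.
Require Import Defs.
From mathcomp Require Import all_boot all_order all_algebra.
From mathcomp Require Import all_classical all_reals all_analysis.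
From mathcomp Require Import ring lra zify.
Import Order.TTheory GRing.Theory Num.Theory.
Import numFieldNormedType.Exports.
Set Implicit Arguments.
Unset Strict Implicit.
Unset Printing Implicit Defensive.
Local Open Scope classical_set_scope.
Local Open Scope ring_scope.

(* Everything is computed on germs of curves that are differentiable at 0.  A
   contraction argument lifts such a curve through a submersion with prescribed
   velocity, so the tangent vectors of a source fibre, of G_2 or of the
   prolongation are velocities of curves lying in it; hence the differential of
   a map on one of these sets does not depend on the extension, and the formulas
   for the invariant vector fields are read off from curves.

   Let a be in A_(beta(g_k))G, xi = T l_(g_k) a and eta = T(r_(g_(k+1)) o i) a.
   The dynamics gives the equation at k from the sections (0, <-X) at k and
   (X, - ->X) at k+1, where X is a section of AG through a; X exists globally by
   a cut-off, and - ->X is a vector field over X because T alpha(->X) =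
   - T beta(X).  Conversely, put
     gam_k (u1, u2, u3) = dL (g_k, g_(k+1)) (u2, u3) + phi_k (u1 - u2):
   this lies in Sigma_L, the matching condition at k forces
   phi_k = - D_2 L (g_(k-1), g_k) for k >= 2, and what is left of it is the
   equation at k-1, except at k = 2, where it only prescribes phi_1 on the
   image of the left translation by g_1. *)

(** * Calculus of C^k maps *)

(** The obstacle is that a tangent map along $G_2$, a source fibre or the prolongation is computed
    with an extension picked by choice, so it cannot be evaluated by unfolding; only its value on
    the velocity of a curve inside the set is under control. Such curves need no regularity away
    from 0, so fixed points taken separately for each time can replace the implicit function
    theorem.

    [D1] and [D2] of an extension are likewise meaningful only in part. The equation regroups as
    dL(0, xi) + dL(xi, eta) + dL(eta, 0), at three consecutive pairs, and each of these vectors is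
    tangent to $G_2$. In the converse, a vector tangent to the prolongation has T alpha(u1) = T
    alpha(u2), so phi_k is only tested on the kernel of T alpha, where D_2 L does not depend on the
    extension.

    The form phi_k is forced for k >= 2 by the freedom in Y once X is fixed: the terms in Y(g_k)
    have to cancel. For k = 1 there is no earlier pair, and the prescribed values extend to a linear
    form because a left translation of a source fibre has a left inverse. *)

Section CkCalculus.
Variable R : realType.
Implicit Types V W : normedModType R.

Lemma diff_compE V V' W (f : V -> V') (g : V' -> W) x v :
  differentiable f x -> differentiable g (f x) ->
  'd (g \o f) x v = 'd g (f x) ('d f x v).
Proof. by move=> df dg; rewrite diff_comp. Qed.

Lemma Ck_le V W k (U : set V) (f : V -> W) : Ck k.+1 U f -> Ck k U f.
Proof.
elim: k f => [|k IH] f [df Df].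
  by move=> x Ux; apply: differentiable_continuous; exact: df.
by split=> // v; apply: IH; exact: Df.
Qed.

Lemma Ck_cont V W k (U : set V) (f : V -> W) : Ck k U f ->
  forall x, U x -> {for x, continuous f}.
Proof. by elim: k f => [|k IH] f // /Ck_le; exact: IH. Qed.

Lemma Ck_sub V W k (U U' : set V) (f : V -> W) : U' `<=` U ->
  Ck k U f -> Ck k U' f.
Proof.
move=> UU'; elim: k f => [|k IH] f; first by move=> cf x /UU'; exact: cf.
move=> [df Df]; split=> [x /UU'|v]; first exact: df.
exact: IH (Df v).
Qed.

Lemma Ck_cst V W k (U : set V) (a : W) : Ck k U (fun=> a).
Proof.
elim: k a => [|k IH] a; first by move=> x _; exact: cst_continuous.
split=> [x _|v]; first exact: differentiable_cst.
have -> : (fun x : V => 'D_v (fun=> a) x) = fun=> 0.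
  by apply/funext => x; rewrite derive_cst.
exact: IH.
Qed.

Lemma Ck_add V W k (U : set V) (f g : V -> W) : open U ->
  Ck k U f -> Ck k U g -> Ck k U (fun x => f x + g x).
Proof.
move=> oU; elim: k f g => [|k IH] f g.
  by move=> cf cg x Ux; apply: continuousD; [exact: cf|exact: cg].
move=> [df Df] [dg Dg]; split=> [x Ux|v].
  by apply: differentiableD; [exact: df|exact: dg].
apply: (Ck_eq oU) (IH _ _ (Df v) (Dg v)) => x Ux.
by rewrite deriveD//; apply: diff_derivable; [exact: df|exact: dg].
Qed.

Lemma Ck_sum V W k (U : set V) n (f : 'I_n -> V -> W) : open U ->
  (forall i, Ck k U (f i)) -> Ck k U (fun x => \sum_i f i x).
Proof.
move=> oU; elim: n f => [|n IH] f cf.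
  have -> : (fun x => \sum_i f i x) = fun=> 0.
    by apply/funext => x; rewrite big_ord0.
  exact: Ck_cst.
have -> : (fun x => \sum_i f i x) =
    fun x => f ord0 x + \sum_(i < n) f (lift ord0 i) x.
  by apply/funext => x; rewrite big_ord_recl.
by apply: Ck_add => //; exact: IH.
Qed.

Lemma Ck_lin V W k (U : set V) (f : {linear V -> W}) :
  continuous f -> Ck k U f.
Proof.
move=> cf; case: k => [|k]; first by move=> x _; exact: cf.
split=> [x _|v]; first exact: linear_differentiable.
have -> : (fun x : V => 'D_v f x) = fun=> f v.
  apply/funext => x; rewrite deriveE ?diff_lin//.
  exact: linear_differentiable.
exact: Ck_cst.
Qed.

(** Scalar multiplication as a named bilinear map, so that the product rule is read off from the
    differential of a bilinear map. *)
Definition scale_of W (a : R) (w : W) := a *: w.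

Lemma scale_is_bilinear W :
  bilinear_for
    (GRing.Scale.Law.clone _ _ *:%R _) (GRing.Scale.Law.clone _ _ *:%R _)
    (@scale_of W).
Proof.
split=> [u'|u] a x y /=.
- by rewrite /scale_of scalerDl scalerA.
- by rewrite /scale_of scalerDr !scalerA mulrC.
Qed.

HB.instance Definition _ W := bilinear_isBilinear.Build R R W W _ _
  (@scale_of W) (scale_is_bilinear W).

Lemma is_diff_scale V W (f : V -> R) (g : V -> W) x :
  differentiable f x -> differentiable g x ->
  is_diff x (fun y => f y *: g y) (fun v => f x *: 'd g x v + 'd f x v *: g x).
Proof.
move=> df dg.
have sc : continuous (fun p : R * W => p.1 *: p.2) by exact: scale_continuous.
have ds := differentiable_bilin (f := @scale_of W) (f x, g x) sc.
have dp : differentiable (fun y => (f y, g y)) x by exact: differentiable_pair.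
apply: DiffDef.
  exact: (@differentiable_comp _ _ _ _ (fun y => (f y, g y)) (fun p =>
    p.1 *: p.2)).
have -> : (fun y => f y *: g y) =
  (fun p : R * W => p.1 *: p.2) \o (fun y => (f y, g y)) by [].
rewrite diff_comp//; apply/funext => v /=.
rewrite (diff_bilin (f := @scale_of W) (f x, g x) sc).
by rewrite /= diff_pair.
Qed.

Lemma Ck_scale V W k (U : set V) (f : V -> R^o) (g : V -> W) : open U ->
  Ck k U f -> Ck k U g -> Ck k U (fun x => (f x : R) *: g x).
Proof.
move=> oU; elim: k f g => [|k IH] f g.
  by move=> cf cg x Ux; apply: continuousZ; [exact: cf|exact: cg].
move=> fk gk; case: (fk) => [df Df]; case: (gk) => [dg Dg]; split=> [x Ux|v].
  by have [] := is_diff_scale (df x Ux) (dg x Ux).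
have h := Ck_add oU (IH _ _ (Ck_le fk) (Dg v)) (IH _ _ (Df v) (Ck_le gk)).
apply: (Ck_eq oU) h => x Ux /=.
have h := is_diff_scale (df x Ux) (dg x Ux).
by rewrite (deriveE v (dg x Ux)) (deriveE v (df x Ux))
  (deriveE v (@ex_diff _ _ _ _ _ _ _ h)) diff_val.
Qed.

Lemma Ck_lin_comp V W W' k (U : set V) (f : V -> W) (l : {linear W -> W'}) :
  open U -> continuous l -> Ck k U f -> Ck k U (fun x => l (f x)).
Proof.
move=> oU cl; elim: k f => [|k IH] f.
  by move=> cf x Ux; apply: continuous_comp; [exact: cf|exact: cl].
have dl y : differentiable l y by exact: linear_differentiable.
move=> [df Df]; split=> [x Ux|w].
  by apply: differentiable_comp; first exact: df.
apply: (Ck_eq oU) (IH _ (Df w)) => x Ux; have dfx := df x Ux.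
have dlf : differentiable (fun y => l (f y)) x by exact: differentiable_comp.
rewrite (deriveE w dfx) (deriveE w dlf) (diff_compE w dfx (dl _)).
by rewrite (diff_lin (f x) cl).
Qed.

(* Continuous linear coordinates, so that a differential is a combination of
   partial derivatives with smooth coefficients. *)
Definition has_coords V :=
  exists n (e : 'I_n -> V) (l : 'I_n -> {linear V -> R^o}),
  (forall i, continuous (l i)) /\ forall v, v = \sum_i l i v *: e i.

(** By the chain rule, the derivative of [g \o f] along [v] is the finite sum of [l i ('D_v f x)]
    times ['D_(e i) g] at [f x]. The induction hypothesis applies to each partial derivative of [g],
    while [f] is only lowered by one order. *)
Lemma Ck_comp V W V' k (U : set V) (U' : set V') (f : V -> V') (g : V' -> W) :
  has_coords V' -> open U -> open U' -> (forall x, U x -> U' (f x)) ->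
  Ck k U f -> Ck k U' g -> Ck k U (g \o f).
Proof.
move=> [n [e [l [cl le]]]] oU oU' UU'; elim: k g => [|k IH] g.
  move=> cf cg x Ux; apply: continuous_comp; first exact: cf.
  by apply: cg; exact: UU'.
move=> fk gk; case: (fk) => [df Df]; case: (gk) => [dg Dg]; split=> [x Ux|v].
  by apply: differentiable_comp; [exact: df|apply: dg; exact: UU'].
have lk i : Ck k U (fun x => l i ('D_v f x))
  by exact: (Ck_lin_comp oU (cl i) (Df v)).
have gk' i : Ck k U ((fun y => 'D_(e i) g y) \o f).
  by apply: IH (Dg _); exact: Ck_le.
apply: (Ck_eq oU) (Ck_sum oU (fun i => Ck_scale oU (lk i) (gk' i))) => x Ux /=.
have dfx := df x Ux; have dgx := dg _ (UU' x Ux).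
have dgf : differentiable (g \o f) x by exact: differentiable_comp.
rewrite (deriveE v dgf) (diff_compE v dfx dgx) (deriveE v dfx)
  [in RHS](le ('d f x v)) linear_sum.
by apply: eq_bigr => i _; rewrite linearZ deriveE.
Qed.

End CkCalculus.

Section Coords.
Variable R : realType.

Lemma coord_linear n (i : 'I_n) : linear (fun v : 'rV[R]_n => v ord0 i : R^o).
Proof. by move=> a u v; rewrite !mxE. Qed.

Definition coord_lin n (i : 'I_n) : {linear 'rV[R]_n -> R^o} :=
  HB.pack (fun v : 'rV[R]_n => v ord0 i : R^o)
    (GRing.isLinear.Build _ _ _ _ _ (coord_linear i)).

Lemma has_coords_rV n : has_coords 'rV[R]_n.
Proof.
exists n, (fun i => delta_mx 0 i).
exists (@coord_lin n).
split=> [i|v]; first by move=> v; exact: coord_continuous.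
by rewrite {1}(row_sum_delta v).
Qed.

Lemma has_coords_R : @has_coords R R^o.
Proof.
exists 1%N, (fun i => 1), (fun i => idfun).
split=> [i v|v]; first exact: cvg_id.
by rewrite big_ord1 [_ *: _]mulr1.
Qed.

Lemma has_coords_pair (V W : normedModType R) :
  has_coords V -> has_coords W -> @has_coords R (V * W)%type.
Proof.
move=> [n [e [l [cl le]]]] [n' [e' [l' [cl' le']]]].
exists (n + n')%N.
exists (fun i : 'I_(n + n') => match fintype.split i with inl j =>
  (e j, 0) | inr j => (0, e' j) end).
pose lV j : {linear (V * W)%type -> R^o} :=
  (l j : {linear V -> R^o}) \o (fst : {linear (V * W)%type -> V}).
pose lW j : {linear (V * W)%type -> R^o} :=
  (l' j : {linear W -> R^o}) \o (snd : {linear (V * W)%type -> W}).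
exists (fun i : 'I_(n + n') => match fintype.split i with inl j =>
  lV j | inr j => lW j end).
split=> [i|[v w]].
  case: (fintype.split i) => j /= x; apply: continuous_comp;
    by [exact: cvg_fst|exact: cvg_snd|exact: cl|exact: cl'].
rewrite big_split_ord /=.
under eq_bigr do rewrite (unsplitK (inl _)) /=.
under [X in _ + X]eq_bigr do rewrite (unsplitK (inr _)) /=.
have -> : \sum_i l i v *: ((e i, 0) : (V * W)%type) = (v, 0).
  rewrite [in RHS](le v) -[RHS]/(pair^~ 0 _).
  elim/big_ind2: _ => // [x a y b -> ->|i _]; congr (_, _);
    by rewrite ?addr0//= scaler0.
have -> : \sum_i l' i w *: ((0, e' i) : (V * W)%type) = (0, w).
  rewrite [in RHS](le' w) -[RHS]/(pair 0 _).
  elim/big_ind2: _ => // [x a y b -> ->|i _]; congr (_, _);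
    by rewrite ?addr0//= scaler0.
by congr (_, _); rewrite /= ?addr0 ?add0r.
Qed.

End Coords.

(** * Germs of smooth maps *)

Section SmoothNear.
Variable R : realType.
Implicit Types V W : normedModType R.

Definition smooth_near V W (f : V -> W) (x : V) : Prop :=
  exists U, open_nbhs x U /\ smooth_on U f.

Lemma smooth_near_nbhs V W (f : V -> W) x :
  smooth_near f x -> \forall y \near x, smooth_near f y.
Proof.
move=> [U [[oU Ux] sf]]; have : nbhs x U by exact: open_nbhs_nbhs.
by apply: filterS => y Uy; exists U.
Qed.

Lemma smooth_near_diff V W (f : V -> W) x : smooth_near f x ->
    differentiable f x.
Proof. by move=> [U [[oU Ux] /(_ 1%N)[df _]]]; exact: df. Qed.

Lemma smooth_near_eq V W (f g : V -> W) x :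
  (\forall y \near x, f y = g y) -> smooth_near f x -> smooth_near g x.
Proof.
rewrite /prop_near1 nbhsE => -[U' [oU' U'x] fg] [U [[oU Ux] sf]].
exists (U `&` U'); split; first by split; [exact: openI|].
move=> k; apply: (Ck_eq (f := f)); first exact: openI.
  by move=> y [_ /fg].
by apply: Ck_sub (sf k) => y [].
Qed.

Lemma smooth_near_comp V V' W (f : V -> V') (g : V' -> W) x :
  has_coords V' -> smooth_near f x -> smooth_near g (f x) ->
  smooth_near (g \o f) x.
Proof.
move=> cV [U [[oU Ux] sf]] [U' [[oU' U'x] sg]].
exists (U `&` f @^-1` U'); have o : open (U `&` f @^-1` U').
  rewrite openE => y [Uy U'y]; apply: filterI.
    exact: open_nbhs_nbhs.
  by apply: (Ck_cont (sf 0%N) Uy); exact: open_nbhs_nbhs.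
split=> // k; apply: (Ck_comp (U' := U')) => //; first by move=> y [].
by apply: Ck_sub (sf k) => y [].
Qed.

Lemma smooth_near_pair V W W' (f : V -> W) (g : V -> W') x :
  smooth_near f x -> smooth_near g x -> smooth_near (fun y => (f y, g y)) x.
Proof.
move=> [U [[oU Ux] sf]] [U' [[oU' U'x] sg]].
exists (U `&` U'); split; first by split; [exact: openI|].
move=> k; apply: Ck_pair; first exact: openI.
  by apply: Ck_sub (sf k) => y [].
by apply: Ck_sub (sg k) => y [].
Qed.

Lemma smooth_near_lin V W (f : {linear V -> W}) x :
  continuous f -> smooth_near f x.
Proof.
move=> cf; exists setT; split; first by split=> //; exact: openT.
by move=> k; exact: Ck_lin.
Qed.

Lemma smooth_near_cst V W (a : W) (x : V) : smooth_near (fun=> a) x.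
Proof.
exists setT; split; first by split=> //; exact: openT.
by move=> k; exact: Ck_cst.
Qed.

Lemma smooth_near_add V W (f g : V -> W) x :
  smooth_near f x -> smooth_near g x -> smooth_near (fun y => f y + g y) x.
Proof.
move=> [U [[oU Ux] sf]] [U' [[oU' U'x] sg]].
exists (U `&` U'); split; first by split; [exact: openI|].
move=> k; apply: Ck_add; first exact: openI.
  by apply: Ck_sub (sf k) => y [].
by apply: Ck_sub (sg k) => y [].
Qed.

Lemma smooth_near_scale V W (f : V -> R^o) (g : V -> W) x :
  smooth_near f x -> smooth_near g x ->
  smooth_near (fun y => (f y : R) *: g y) x.
Proof.
move=> [U [[oU Ux] sf]] [U' [[oU' U'x] sg]].
exists (U `&` U'); split; first by split; [exact: openI|].
move=> k; apply: Ck_scale; first exact: openI.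
  by apply: Ck_sub (sf k) => y [].
by apply: Ck_sub (sg k) => y [].
Qed.

Lemma smooth_near_sum V W n (f : 'I_n -> V -> W) x :
  (forall i, smooth_near (f i) x) -> smooth_near (fun y => \sum_i f i y) x.
Proof.
elim: n f => [|n IH] f sf.
  apply: smooth_near_eq (smooth_near_cst 0 x).
  by apply: nearW => y; rewrite big_ord0.
apply: smooth_near_eq
  (smooth_near_add (sf ord0) (IH _ (fun i => sf (lift ord0 i)))).
by apply: nearW => y; rewrite big_ord_recl.
Qed.

Lemma smooth_near_derive V W (f : V -> W) v x :
  smooth_near f x -> smooth_near (fun y => 'D_v f y) x.
Proof.
by move=> [U [oU sf]]; exists U; split=> // k; have [_] := sf k.+1; exact.
Qed.

(** Joint smoothness in the base point and the vector: the differential is the sum of the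
    coordinates of [b z] times the partial derivatives at [a z]. *)
Lemma smooth_near_diff_comp V V' W (f : V' -> W) (a b : V -> V') x :
  has_coords V' -> smooth_near f (a x) -> smooth_near a x -> smooth_near b x ->
  smooth_near (fun z => 'd f (a z) (b z)) x.
Proof.
move=> cV sf sa sb; case: (cV) => n [e [l [cl le]]].
have lb i : smooth_near (l i \o b) x.
  by apply: smooth_near_comp => //; exact: smooth_near_lin.
have fa i : smooth_near ((fun y => 'D_(e i) f y) \o a) x.
  by apply: smooth_near_comp => //; exact: smooth_near_derive.
apply: smooth_near_eq (smooth_near_sum (fun i =>
  smooth_near_scale (lb i) (fa i))).
have : \forall z \near x, smooth_near f (a z).
  apply: (differentiable_continuous (smooth_near_diff sa)).
  exact: smooth_near_nbhs.
apply: filterS => z /smooth_near_diff df.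
rewrite [in RHS](le (b z)) linear_sum; apply: eq_bigr => i _ /=.
by rewrite linearZ deriveE.
Qed.

Lemma smooth_near_prod V n (f : 'I_n -> V -> R^o) x :
  (forall i, smooth_near (f i) x) ->
  smooth_near (fun y => (\prod_i (f i y : R)) : R^o) x.
Proof.
elim: n f => [|n IH] f sf.
  apply: smooth_near_eq (smooth_near_cst (1 : R^o) x).
  by apply: nearW => y; rewrite big_ord0.
apply: smooth_near_eq
  (smooth_near_scale (sf ord0) (IH _ (fun i => sf (lift ord0 i)))).
by apply: nearW => y; rewrite big_ord_recl.
Qed.

End SmoothNear.

(** * Lifting curves through a submersion *)

Section StrictDiff.
Variable R : realType.

Lemma is_derive_comp (V W : normedModType R) (f : V -> W) (c : R -> V) (t : R)
    (v : V) :
  differentiable f (c t) -> is_derive t 1 c v ->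
  is_derive t 1 (f \o c) ('d f (c t) v).
Proof.
move=> df dc; have dct : differentiable c t by apply/derivable1_diffP;
  exact: ex_derive.
have dfc : differentiable (f \o c) t by exact: differentiable_comp.
apply: DeriveDef; first exact/derivable1_diffP.
rewrite (deriveE _ dfc) (diff_compE _ dct df); congr ('d f _ _).
by rewrite -(deriveE _ dct) derive_val.
Qed.

Lemma is_derive_lin (V W : normedModType R) (l : {linear V -> W}) (c : R -> V)
    (t : R) (v : V) :
  continuous l -> is_derive t 1 c v -> is_derive t 1 (fun s => l (c s)) (l v).
Proof.
move=> cl dc; have := is_derive_comp (linear_differentiable (c t) cl) dc.
by rewrite (diff_lin _ cl).
Qed.

Lemma is_derive_line (V : normedModType R) (w : V) (t : R) :
  is_derive t (1 : R) (fun s : R => s *: w) w.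
Proof.
have h : is_diff t (fun s : R => s *: w) (fun s : R => s *: w).
  exact: is_diff_scalel.
have dh : differentiable (fun s : R => s *: w) t by exact: ex_diff.
apply: DeriveDef; first exact/derivable1_diffP.
by rewrite (deriveE _ dh) diff_val scale1r.
Qed.

(** Continuity of the differential in operator norm. Partial derivatives are continuous one
    direction at a time; finitely many basis directions, weighted by the Lipschitz constants [K i]
    of the coordinates, make the estimate uniform in [v]. *)
Lemma diff_near_le (V W : normedModType R) (f : V -> W) x e :
  has_coords V -> smooth_near f x -> 0 < e ->
  \forall z \near x, differentiable f z /\
    forall v, `|'d f z v - 'd f x v| <= e * `|v|.
Proof.
move=> [n [b [l [cl le]]]] sf e0.
have /choice [K HK] : forall i, exists k, forall v, `|l i v| <= k * `|v|.
  by move=> i; have [k _ Hk] := linear_lipschitz (cl i); exists k.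
have ch : {for x, continuous (fun z =>
    \sum_i K i * `|'D_(b i) f z - 'D_(b i) f x|)}.
  apply: cvg_big => [|i _]; first exact: add_continuous.
  apply: cvgM; first exact: cvg_cst.
  apply: cvg_norm; apply: cvgB; last exact: cvg_cst.
  exact: (differentiable_continuous (smooth_near_diff
    (smooth_near_derive _ sf))).
have h0 : \sum_i K i * `|'D_(b i) f x - 'D_(b i) f x| = 0.
  by rewrite big1// => i _; rewrite subrr normr0 mulr0.
have /= hn := cvgr_lt _ ch e; rewrite h0 in hn.
near=> z.
have dz : differentiable f z.
  by apply: smooth_near_diff; near: z; exact: smooth_near_nbhs.
have dx : differentiable f x by exact: smooth_near_diff.
split=> // v.
have dE u : 'd f u v = \sum_i l i v *: 'd f u (b i).
  by rewrite {1}(le v) linear_sum; apply: eq_bigr => i _; rewrite linearZ.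
rewrite !dE -sumrB.
apply: (le_trans (ler_norm_sum _ _ _)).
have hz : \sum_i K i * `|'D_(b i) f z - 'D_(b i) f x| < e.
  by near: z; exact: hn.
apply: (@le_trans _ _ ((\sum_i K i * `|'D_(b i) f z - 'D_(b i) f x|) * `|v|)).
  rewrite mulr_suml; apply: ler_sum => i _.
  rewrite -scalerBr normrZ (deriveE _ dz) (deriveE _ dx) mulrAC.
  by apply: ler_wpM2r => //; exact: HK.
by apply: ler_wpM2r => //; exact: ltW.
Unshelve. all: by end_near. Qed.

Lemma norm_rV_le n (v : 'rV[R]_n) e : 0 <= e ->
  (forall j, `|v ord0 j| <= e) -> `|v| <= e.
Proof.
move=> e0 H; rewrite /Num.norm/= mx_normrE; apply: bigmax_le => // -[i j] _ /=.
by rewrite ord1; exact: H.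
Qed.

Lemma coord_rV_le n (v : 'rV[R]_n) j : `|v ord0 j| <= `|v|.
Proof.
rewrite [leRHS]/Num.norm/= mx_normrE.
exact: (le_bigmax _ (fun i : 'I_1 * 'I_n => `|v i.1 i.2|) (ord0, j)).
Qed.

(** Mean value theorem for each coordinate of [F], the restriction of [f] to a segment minus its
    linear part. The norm of row vectors is the maximum of the coordinates, so the coordinatewise
    bounds combine without loss. *)
Lemma strict_diff (V : normedModType R) m (f : V -> 'rV[R]_m) x e :
  has_coords V -> smooth_near f x -> 0 < e ->
  exists2 d, 0 < d & forall y z, `|y - x| < d -> `|z - x| < d ->
    `|f y - f z - 'd f x (y - z)| <= e * `|y - z|.
Proof.
move=> cV sf e0; have /nbhs_normP[d /= d0 H] := diff_near_le cV sf e0.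
exists d => // y z yd zd; set w := y - z.
pose F t : 'rV[R]_m := f (z + t *: w) - t *: 'd f x w.
have inb (t : R) : t \in `[0, 1] -> `|x - (z + t *: w)| < d.
  rewrite in_itv/= => /andP[t0 t1].
  have -> : x - (z + t *: w) = (1 - t) *: (x - z) + t *: (x - y).
    have -> : x - y = (x - z) - w by rewrite /w opprB addrA subrK.
    rewrite scalerBl scale1r (scalerBr t (x - z) w) addrA subrK.
    by rewrite opprD addrA.
  apply: (le_lt_trans (ler_normD _ _)); rewrite !normrZ.
  rewrite (distrC x z) (distrC x y) !ger0_norm ?subr_ge0//.
  (* Strictness comes from the summand weighted by [t], which needs [t != 0]. *)
  have [->|tn0] := eqVneq t 0; first by rewrite mul0r addr0 subr0 mul1r.
  have -> : d = (1 - t) * d + t * d by rewrite -mulrDl subrK mul1r.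
  apply: ler_ltD; last by rewrite ltr_pM2l// lt0r tn0.
  by apply: ler_wpM2l; rewrite ?subr_ge0// ltW.
have dF (t : R) : t \in `[0, 1] -> is_derive t (1 : R) F
  ('d f (z + t *: w) w - 'd f x w).
  move=> /inb /H[dft _].
  have dc : is_derive t (1 : R) (fun t : R => z + t *: w) w.
    have := is_deriveD (is_derive_cst z t 1) (is_derive_line w t).
    by rewrite add0r.
  have := is_derive_comp dft dc; rewrite /comp => d1.
  have d2 : is_derive t (1 : R) (fun t : R => t *: 'd f x w) ('d f x w).
    exact: is_derive_line.
  exact: is_deriveB.
have F1 : F 1 = f y - 'd f x w by rewrite /F !scale1r /w [z + _]addrC subrK.
have F0 : F 0 = f z by rewrite /F !scale0r addr0 subr0.
have -> : f y - f z - 'd f x w = F 1 - F 0 by rewrite F1 F0 addrAC.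
apply: norm_rV_le => [|j]; first by rewrite mulr_ge0// ltW.
have dj (t : R) : t \in `[0, 1] -> is_derive t (1 : R) (fun s => F s ord0 j : R)
    (('d f (z + t *: w) w - 'd f x w) ord0 j).
  move=> /dF dFt.
  exact: (is_derive_lin (l := coord_lin R j) (@coord_continuous _ _ _ _ _) dFt).
pose phi (s : R) : R := F s ord0 j.
pose dphi (t : R) : R := ('d f (z + t *: w) w - 'd f x w) ord0 j.
have hd (t : R) : t \in `]0, 1[ -> is_derive t (1 : R) phi (dphi t).
  by move=> /subset_itv_oo_cc/dj.
have hc : {within `[0, 1], continuous phi}.
  by apply: derivable_within_continuous => t /dj/@ex_derive.
have [t ti E] := MVT ltr01 hd hc.
have -> : (F 1 - F 0) ord0 j = dphi t.
  by move: E; rewrite subr0 mulr1 => <-; rewrite [LHS]mxE [X in _ + X]mxE.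
have /H[_ Ht] := inb t (subset_itv_oo_cc ti).
exact: le_trans (coord_rV_le _ j) (Ht w).
Qed.

End StrictDiff.

(** Joins completeness with the norm on matrices, as the Banach fixed point theorem requires for row
    vectors. *)
HB.instance Definition _ (R : realType) m n := Complete.on 'M[R]_(m, n).

Section CurveLift.
Variable R : realType.

(** Squeezes difference quotients. It serves twice: for the correction term of a lifted curve, and
    at 0 for the flat function. *)
Lemma is_derive0_dom (V W : normedModType R) (g : R -> V) (u : R -> W) C :
  g 0 = 0 -> is_derive (0 : R) (1 : R) g 0 ->
  (\forall t \near 0, `|u t| <= C * `|g t|) -> is_derive (0 : R) (1 : R) u 0.
Proof.
move=> g0 dg ug.
have u0 : u 0 = 0.
  apply/eqP; rewrite -normr_le0.
  by have := nbhs_singleton ug; rewrite g0 normr0 mulr0.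
have gc : (fun h : R => h^-1 *: (g (h *: 1 + 0) - g 0)) @ 0^' --> (0 : V).
  have dg0 : derivable g 0 1 by exact: ex_derive.
  have e : 'D_1 g 0 = 0 by exact: derive_val.
  by rewrite -e; exact: dg0.
have uc : (fun h : R => h^-1 *: (u (h *: 1 + 0) - u 0)) @ 0^' --> (0 : W).
  apply/norm_cvg0P.
  have gn : C * `|h^-1 *: (g (h *: 1 + 0) - g 0)| @[h --> (0 : R)^'] -->
    (0 : R).
    rewrite -[X in _ --> X](mulr0 C); apply: cvgM; first exact: cvg_cst.
    by have := cvg_norm gc; rewrite normr0; exact.
  have ug' : \forall t \near (0 : R)^', `|u t| <= C * `|g t|
    by exact: nbhs_dnbhs ug.
  apply: squeeze_cvgr (cvg_cst _) gn.
  apply: filterS ug' => h ugh; rewrite normr_ge0/= !addr0 [_%:A]mulr1.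
  rewrite g0 u0 !subr0 !normrZ /= mulrCA; exact: ler_wpM2l.
apply: DeriveDef; first by apply/cvg_ex; exists 0.
exact: cvg_lim uc.
Qed.

(** The line [x + t *: v] is corrected by [S w], with [S] a linear right inverse of the
    differential. For each [t], [w] is the fixed point of a simplified Newton map. It is bounded by
    the error of the uncorrected line, which has derivative 0, so the velocity stays [v]. *)
Lemma curve_lift (V : normedModType R) m (f : V -> 'rV[R]_m) x v (p : R ->
    'rV[R]_m) :
  has_coords V -> smooth_near f x -> (forall w, exists u, 'd f x u = w) ->
  p 0 = f x -> is_derive (0 : R) (1 : R) p ('d f x v) ->
  exists c : R -> V, [/\ c 0 = x, is_derive (0 : R) (1 : R) c v &
    \forall t \near 0, f (c t) = p t].
Proof.
move=> cV sf sur p0 dp.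
have /choice [s Hs] : forall j, exists u, 'd f x u = delta_mx 0 j.
  by move=> j; exact: sur.
pose S (w : 'rV[R]_m) : V := \sum_j w ord0 j *: s j.
(* A bound for the norm of [S]; adding 1 keeps [K] positive even if all [s j] vanish. *)
pose K : R := \sum_j `|s j| + 1.
have K0 : 0 < K by rewrite ltr_wpDl// sumr_ge0.
have SB w w' : S w - S w' = S (w - w').
  rewrite /S -sumrB; apply: eq_bigr => j _.
  by rewrite [(w - w') _ _]mxE [(- w') _ _]mxE scalerBl.
have S0 : S 0 = 0 by rewrite -(subrr (0 : 'rV_m)) -SB subrr.
have SK w : `|S w| <= K * `|w|.
  apply: (le_trans (ler_norm_sum _ _ _)).
  rewrite mulrDl mul1r mulr_suml ler_wpDr//; apply: ler_sum => j _.
  by rewrite normrZ mulrC ler_wpM2l// coord_rV_le.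
have dS w : 'd f x (S w) = w.
  rewrite /S linear_sum {2}(row_sum_delta w); apply: eq_bigr => j _.
  by rewrite linearZ Hs.
(* Together with the bound [K] on [S], this precision gives the contraction factor 1/2. The radius
   [dl] makes [S w] at most [d / 4], which leaves room for [t *: v], below [d / 2]. *)
have e0 : 0 < (2 * K)^-1 by rewrite invr_gt0 mulr_gt0.
have [d d0 strict] := strict_diff cV sf e0.
pose dl := d / (4 * K); have dl0 : 0 < dl by rewrite divr_gt0// mulr_gt0.
pose g (t : R) := f (x + t *: v) - p t.
have dg : is_derive (0 : R) (1 : R) g 0.
  have d1 : is_derive (0 : R) (1 : R) (fun t : R => x + t *: v) v.
    have := is_deriveD (is_derive_cst x (0 : R) 1) (is_derive_line v 0).
    by rewrite add0r.
  have dfx : differentiable f (x + (0 : R) *: v).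
    by rewrite scale0r addr0; exact: smooth_near_diff.
  have := is_derive_comp dfx d1; rewrite scale0r addr0 => d2.
  by have := is_deriveB d2 dp; rewrite subrr.
have g0 : g 0 = 0 by rewrite /g scale0r addr0 p0 subrr.
have cg : {for 0, continuous g}.
  by apply: differentiable_continuous; apply/derivable1_diffP; exact: ex_derive.
have lifts : \forall t \near (0 : R), exists w,
    f (x + t *: v + S w) = p t /\ `|w| <= 2 * `|g t|.
  have n1 : \forall t \near (0 : R), `|g t| < dl / 2.
    have := cvgr_norm_lt _ cg (dl / 2); rewrite g0 normr0; apply.
    exact: divr_gt0.
  have n2 : \forall t \near (0 : R), `|t *: v| < d / 2.
    have cl : {for (0 : R), continuous (fun t : R => t *: v)}.
      exact: scalel_continuous.
    have := cvgr_norm_lt _ cl (d / 2); rewrite scale0r normr0; apply.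
    exact: divr_gt0.
  apply: filterS2 n1 n2 => t gt tv.
  pose U := [set w : 'rV[R]_m | `|w| <= dl].
  pose F w := w - (f (x + t *: v + S w) - p t).
  have inb w : U w -> `|x + t *: v + S w - x| < d.
    move=> Uw; rewrite -(addrA x) (addrC x) addrK.
    apply: (le_lt_trans (ler_normD _ _)); rewrite (splitr d) ltrD//.
    apply: (le_lt_trans (SK w)).
    apply: (@le_lt_trans _ _ (K * dl)); first by rewrite ler_wpM2l// ltW.
    have -> : K * dl = d / 4.
      by rewrite /dl; field; rewrite gt_eqF.
    by rewrite ltr_pM2l// ltf_pV2 ?posrE// ltr_nat.
  have Fc w w' : U w -> U w' -> `|F w - F w'| <= 2^-1 * `|w - w'|.
    move=> Uw Uw'.
    have := strict _ _ (inb _ Uw) (inb _ Uw').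
    have -> : x + t *: v + S w - (x + t *: v + S w') = S (w - w').
      by rewrite opprD addrACA subrr add0r SB.
    rewrite dS => h.
    have -> : F w - F w' = - (f (x + t *: v + S w) - f (x + t *: v + S w') -
      (w - w')).
      by apply/rowP => j; rewrite /F !mxE; ring.
    rewrite normrN; apply: (le_trans h).
    apply: (@le_trans _ _ ((2 * K)^-1 * (K * `|w - w'|))).
      by rewrite ler_wpM2l// ltW.
    rewrite (_ : _ * (K * _) = 2^-1 * `|w - w'|)//; field.
    by rewrite gt_eqF.
  have U0 : U 0 by rewrite /U /= normr0 ltW.
  have F0 : F 0 = - g t by rewrite /F S0 addr0 sub0r.
  (* The ball is stable: contraction contributes at most [dl / 2], and [F 0 = - g t] is below
     [dl / 2]. *)
  have FU : set_fun U U F.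
    move=> w Uw; rewrite /U /= -(subrK (F 0) (F w)).
    apply: (le_trans (ler_normD _ _)); rewrite F0 normrN -F0 (splitr dl).
    apply: lerD; last exact: ltW.
    apply: (le_trans (Fc _ _ Uw U0)).
    by rewrite subr0 mulrC ler_wpM2r// invr_ge0.
  pose Fun : {fun U >-> U} := HB.pack F (isFun.Build _ _ U U F FU).
  have ctr : is_contraction Fun.
    exists (2^-1%:nng); split; first by rewrite /= invf_lt1// ltr1n.
    by move=> [w w'] [/= Uw Uw']; exact: Fc.
  have cU : closed U.
    apply: (@closed_comp _ _ (fun w : 'rV[R]_m => `|w|) [set r : R | r <= dl]).
      by move=> w _; exact: norm_continuous.
    exact: closed_le.
  have [w Uw wF] := banach_fixed_point ctr cU (ex_intro _ 0 U0).
  have {}wF : F w = w by rewrite {2}wF.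
  exists w; split.
    apply/eqP; rewrite -subr_eq0; apply/eqP.
    by move/eqP: wF; rewrite /F -subr_eq0 addrAC subrr add0r oppr_eq0 => /eqP.
  have := Fc _ _ Uw U0; rewrite wF F0 subr0 opprK => h.
  have : `|w| <= `|w + g t| + `|g t|.
    by rewrite -{1}(addrK (g t) w); exact: ler_normB.
  move=> h'; have {}h' := le_trans h' (lerD h (lexx _)).
  lra.
(* Choice needs a statement for every [t]; away from 0, where no solution is guaranteed, the value
   is irrelevant. *)
have /choice [w Hw] : forall t : R, exists w,
  (exists w, f (x + t *: v + S w) = p t /\ `|w| <= 2 * `|g t|) ->
    f (x + t *: v + S w) = p t /\ `|w| <= 2 * `|g t|.
  move=> t; have [[w H]|n] := pselect (exists w,
    f (x + t *: v + S w) = p t /\ `|w| <= 2 * `|g t|).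
    by exists w.
  by exists 0.
have {lifts}Hw : \forall t \near (0 : R),
  f (x + t *: v + S (w t)) = p t /\ `|w t| <= 2 * `|g t|.
  by apply: filterS lifts => t; exact: Hw.
exists (fun t => x + t *: v + S (w t)); split.
- have := (nbhs_singleton Hw).2; rewrite g0 normr0 mulr0 normr_le0 => /eqP ->.
  by rewrite scale0r S0 !addr0.
- have d1 : is_derive (0 : R) (1 : R) (fun t : R => x + t *: v) v.
    have := is_deriveD (is_derive_cst x (0 : R) 1) (is_derive_line v 0).
    by rewrite add0r.
  have d2 : is_derive (0 : R) (1 : R) (fun t : R => S (w t)) 0.
    apply: (is_derive0_dom (C := 2 * K) g0 dg).
    apply: filterS Hw => t [_ wt]; apply: (le_trans (SK _)).
    by rewrite -mulrA mulrCA ler_wpM2l// ltW.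
  by have := is_deriveD d1 d2; rewrite addr0.
- by apply: filterS Hw => t [].
Qed.

End CurveLift.

(** * Maps and curves between manifolds *)

Section Charts.
Variables (R : realType) (E : normedModType R).

Lemma near_cpsi (M : topologicalType) (c : chart E M) p (P : set M) :
  cdom c p -> nbhs p P -> \forall x \near cphi c p, P (cpsi c x).
Proof.
move=> cp Pp; have ip := cphi_img cp.
by apply: (cpsi_continuous ip); rewrite cphiK.
Qed.

Lemma near_cphi (M : topologicalType) (c : chart E M) p (P : set E) :
  cdom c p -> nbhs (cphi c p) P -> \forall q \near p, P (cphi c q).
Proof. by move=> cp Pp; exact: (cphi_continuous cp). Qed.

Lemma near_cdom (M : topologicalType) (c : chart E M) p :
  cdom c p -> \forall q \near p, cdom c q.
Proof. by move=> cp; apply: open_nbhs_nbhs; split=> //; exact: cdom_open. Qed.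

Lemma near_cimg (M : topologicalType) (c : chart E M) x :
  cimg c x -> \forall y \near x, cimg c y.
Proof. by move=> cp; apply: open_nbhs_nbhs; split=> //; exact: cimg_open. Qed.

Lemma transition_smooth (M : atlas_space E) (p q : M) x :
  cimg (chart_at p) x -> cdom (chart_at q) (cpsi (chart_at p) x) ->
  smooth_near (cphi (chart_at q) \o cpsi (chart_at p)) x.
Proof.
move=> px qx; eexists; split; last exact: chart_compat.
by split=> //; exact: chart_overlap_open.
Qed.

End Charts.
#[local] Hint Resolve chart_at_dom : core.

Lemma continuous_near_eq (S T : topologicalType) (f g : S -> T) (p : S) :
  (\forall q \near p, f q = g q) -> {for p, continuous f} ->
    {for p, continuous g}.
Proof.
move=> fg; rewrite /prop_for /continuous_at (nbhs_singleton fg).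
by apply: cvg_trans; exact: near_eq_cvg.
Qed.

Section MDiff.
Variable R : realType.

(** Continuity is a separate requirement because [local_rep] uses total chart functions: where [f]
    leaves the chart of index [f p], their values are arbitrary and say nothing about [f]. *)
Definition mdiff (E F : normedModType R) (M : atlas_space E) (N : atlas_space F)
    (f : M -> N) (p : M) : Prop :=
  {for p, continuous f} /\ differentiable (local_rep f p) (cphi (chart_at p) p).

Variables (E F : normedModType R) (M : atlas_space E) (N : atlas_space F).
Implicit Types (f g : M -> N) (p : M).

Lemma local_repE f p : local_rep f p (cphi (chart_at p) p) = cphi
    (chart_at (f p)) (f p).
Proof. by rewrite /local_rep /= cphiK. Qed.

Lemma local_rep_continuous f p :
  (\forall q \near p, cdom (chart_at (f p)) (f q)) ->
  {for cphi (chart_at p) p, continuous (local_rep f p)} ->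
    {for p, continuous f}.
Proof.
move=> nd cl P fP.
have h1 := near_cpsi (c := chart_at (f p)) (chart_at_dom _) fP.
rewrite -local_repE in h1.
have /= h2 := near_cphi (c := chart_at p) (chart_at_dom _) (cl _ h1).
apply: filterS3 h2 nd (near_cdom (chart_at_dom p)) => q.
by rewrite /local_rep /= => H dq pq; move: H; rewrite !cphiK.
Qed.

(** Continuity at [p] is what turns a neighbourhood of smoothness of [local_rep] into one that stays
    inside both charts. This form composes by germs. *)
Lemma smooth_atP f p : smooth_at f p <->
  {for p, continuous f} /\ smooth_near (local_rep f p) (cphi (chart_at p) p).
Proof.
split=> [[U [[oU Up] Ui Ud sU]]|[cf [U [[oU Up] sU]]]].
  split; last by exists U.
  apply: local_rep_continuous; last first.
    by apply: (Ck_cont (sU 0%N)).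
  have /= nU := near_cphi (c := chart_at p) (chart_at_dom _)
    (open_nbhs_nbhs (conj oU Up)).
  apply: filterS2 nU (near_cdom (chart_at_dom p)) => q qU dq.
  by have := Ud _ qU; rewrite /= cphiK.
have n1 := near_cimg (cphi_img (chart_at_dom p)).
have n2 := near_cpsi (chart_at_dom p) (cf _ (near_cdom (chart_at_dom (f p)))).
have : nbhs (cphi (chart_at p) p) (U `&` (cimg (chart_at p) `&`
    [set x | cdom (chart_at (f p)) (f (cpsi (chart_at p) x))])).
  by apply: filterI; [exact: open_nbhs_nbhs|exact: filterI].
rewrite nbhsE => -[V oV VU]; exists V; split=> //.
- by move=> x /VU[_ []].
- by move=> x /VU[_ []].
- by move=> k; apply: Ck_sub (sU k) => x /VU[].
Qed.

Lemma smooth_at_mdiff f p : smooth_at f p -> mdiff f p.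
Proof. by move=> /smooth_atP[cf sf]; split=> //; exact: smooth_near_diff. Qed.

Lemma mdiff_near f p (P : set N) :
  mdiff f p -> (\forall q \near f p, P q) -> \forall q \near p, P (f q).
Proof. by move=> [cf _] /cf. Qed.

Lemma smooth_at_near f p (P : set N) :
  smooth_at f p -> (\forall q \near f p, P q) -> \forall q \near p, P (f q).
Proof. by move=> /smooth_at_mdiff; exact: mdiff_near. Qed.

Lemma local_rep_eq f g p : (\forall q \near p, f q = g q) ->
  \forall x \near cphi (chart_at p) p, local_rep f p x = local_rep g p x.
Proof.
move=> fg; have fgp := nbhs_singleton fg.
have := near_cpsi (chart_at_dom p) fg.
by apply: filterS => x /= H; rewrite /local_rep /= H fgp.
Qed.

Lemma smooth_at_eq f g p : (\forall q \near p, f q = g q) ->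
  smooth_at f p -> smooth_at g p.
Proof.
move=> fg /smooth_atP[cf sf]; apply/smooth_atP; split.
  exact: continuous_near_eq fg cf.
exact: smooth_near_eq (local_rep_eq fg) sf.
Qed.

Lemma mdiff_eq f g p : (\forall q \near p, f q = g q) -> mdiff f p -> mdiff g p.
Proof.
move=> fg [cf sf]; split; first exact: continuous_near_eq fg cf.
exact: near_differentiable (local_rep_eq fg) sf.
Qed.

Lemma tmap_eq f g p v : (\forall q \near p, f q = g q) -> mdiff f p ->
  tmap f p v = tmap g p v.
Proof.
move=> fg df; have [_ dg] := mdiff_eq fg df; have [_ df'] := df.
rewrite /tmap -(deriveE _ df') -(deriveE _ dg).
exact: near_eq_derive (local_rep_eq fg).
Qed.

Lemma tmapD f p u v : tmap f p (u + v) = tmap f p u + tmap f p v.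
Proof. exact: linearD. Qed.

Lemma tmapZ f p a v : tmap f p (a *: v) = a *: tmap f p v.
Proof. exact: linearZ. Qed.

Lemma tmap0 f p : tmap f p 0 = 0.
Proof. exact: linear0. Qed.
End MDiff.

Section MComp.
Variables (R : realType) (E F H : normedModType R).
Variables (M : atlas_space E) (N : atlas_space F) (Q : atlas_space H).
Variables (f : M -> N) (g : N -> Q) (p : M).

Lemma local_rep_comp : {for p, continuous f} ->
  \forall x \near cphi (chart_at p) p,
    (local_rep g (f p) \o local_rep f p) x = local_rep (g \o f) p x.
Proof.
move=> cf; have := near_cpsi (chart_at_dom p)
  (cf _ (near_cdom (chart_at_dom (f p)))).
by apply: filterS => x /= H'; rewrite /local_rep /= cphiK.
Qed.

Lemma smooth_at_comp : has_coords F -> smooth_at f p -> smooth_at g (f p) ->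
  smooth_at (g \o f) p.
Proof.
move=> cF /smooth_atP[cf sf] /smooth_atP[cg sg]; apply/smooth_atP; split.
  exact: continuous_comp.
apply: smooth_near_eq (local_rep_comp cf) _.
by apply: smooth_near_comp => //; rewrite local_repE.
Qed.

Lemma mdiff_comp : mdiff f p -> mdiff g (f p) -> mdiff (g \o f) p.
Proof.
move=> [cf df] [cg dg]; split; first exact: continuous_comp.
apply: near_differentiable (local_rep_comp cf) _.
by apply: differentiable_comp => //; rewrite local_repE.
Qed.

Lemma tmap_comp v : mdiff f p -> mdiff g (f p) ->
  tmap (g \o f) p v = tmap g (f p) (tmap f p v).
Proof.
move=> df dg; have [_ dgf] := mdiff_comp df dg.
case: df dg => [cf df] [cg dg]; rewrite /tmap -(deriveE _ dgf).
rewrite -(near_eq_derive v (local_rep_comp cf)) deriveE; last first.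
  by apply: differentiable_comp => //; rewrite local_repE.
by rewrite diff_compE// local_repE.
Qed.

End MComp.

Section FlatMaps.
Variables (R : realType) (E F : normedModType R).

Lemma smooth_at_flat (f : flat_space E -> flat_space F) x :
  smooth_at f x <-> @smooth_near R E F f x.
Proof.
split=> [/smooth_atP[]//|sf]; apply/smooth_atP; split=> //.
exact: (differentiable_continuous (smooth_near_diff sf)).
Qed.

Lemma mdiff_flat (f : flat_space E -> flat_space F) (x : E) :
  mdiff f x <-> @differentiable_def R E F f _ (Phantom _ (nbhs x)).
Proof.
split=> [[]//|df]; split=> //; exact: (differentiable_continuous df).
Qed.

Variable (M : atlas_space E).

Lemma smooth_at_cphi (c p : M) : cdom (chart_at c) p ->
  smooth_at (N := flat_space E) (cphi (chart_at c)) p.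
Proof.
move=> cp; apply/smooth_atP; split; first exact: cphi_continuous.
apply: transition_smooth; first exact: cphi_img.
by rewrite cphiK.
Qed.

Lemma smooth_at_cpsi (c : M) (x : E) : cimg (chart_at c) x ->
  smooth_at (M := flat_space E) (cpsi (chart_at c)) x.
Proof.
move=> cx; apply/smooth_atP; split; first exact: cpsi_continuous.
exact: transition_smooth.
Qed.

Lemma tmap_cphi (c p : M) v :
  tmap (N := flat_space E) (cphi (chart_at c)) p v = components c p v.
Proof. by []. Qed.

Lemma smooth_at_id (p : M) : smooth_at (@id M) p.
Proof.
apply/smooth_atP; split; first exact: cvg_id.
have h := cphi_img (chart_at_dom p).
by apply: transition_smooth => //; rewrite cphiK.
Qed.

Lemma tmap_id (p : M) v : tmap (@id M) p v = v.
Proof.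
have d : mdiff (@id M) p by apply: smooth_at_mdiff; exact: smooth_at_id.
rewrite /tmap -deriveE; last exact: d.2.
rewrite -(@near_eq_derive _ _ _ id) ?derive_id//.
have := near_cimg (cphi_img (chart_at_dom p)); apply: filterS => x xc.
by rewrite /local_rep /= cpsiK.
Qed.

Lemma components_id (p : M) v : components p p v = v.
Proof. by rewrite -[RHS](tmap_id p). Qed.

Lemma tmap_cpsi (p : M) v :
  tmap (M := flat_space E) (cpsi (chart_at p)) (cphi (chart_at p) p) v = v.
Proof.
have m1 : mdiff (N := flat_space E) (cphi (chart_at p)) p.
  exact/smooth_at_mdiff/smooth_at_cphi.
have mp : mdiff (M := flat_space E) (cpsi (chart_at p)) (cphi (chart_at p) p).
  by apply/smooth_at_mdiff/smooth_at_cpsi; exact: cphi_img.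
have cc : tmap (cpsi (chart_at p) \o cphi (chart_at p)) p v = v.
  rewrite -[RHS](tmap_id p); apply: tmap_eq.
    by apply: filterS (near_cdom (chart_at_dom p)) => q; exact: cphiK.
  exact: mdiff_comp m1 mp.
by rewrite -[RHS]cc [RHS](tmap_comp v m1 mp) tmap_cphi components_id.
Qed.

Variable (N : atlas_space F).

Lemma smooth_at_cst (b : N) (p : M) : smooth_at (fun _ : M => b) p.
Proof.
apply/smooth_atP; split; first exact: cst_continuous.
exact: smooth_near_cst.
Qed.

Lemma tmap_cst (b : N) (p : M) v : tmap (fun _ : M => b) p v = 0.
Proof.
rewrite /tmap; have -> : local_rep (fun _ : M => b) p = cst
  (cphi (chart_at b) b).
  by [].
by rewrite diff_cst.
Qed.

End FlatMaps.

Section ProductMaps.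
Variables (R : realType) (E F H : normedModType R).
Variables (M : atlas_space E) (N : atlas_space F) (Q : atlas_space H).
Local Notation MN := (prod_space M N).

Lemma fst_rep (p : MN) : \forall x \near cphi (chart_at p) p,
  x.1 = local_rep (M := MN) (N := M) fst p x.
Proof.
have := near_cimg (cphi_img (chart_at_dom p)).
by apply: filterS => x [x1 x2]; rewrite /local_rep /= cpsiK.
Qed.

Lemma snd_rep (p : MN) : \forall x \near cphi (chart_at p) p,
  x.2 = local_rep (M := MN) (N := N) snd p x.
Proof.
have := near_cimg (cphi_img (chart_at_dom p)).
by apply: filterS => x [x1 x2]; rewrite /local_rep /= cpsiK.
Qed.

Lemma smooth_at_fst (p : MN) : smooth_at (M := MN) (N := M) fst p.
Proof.
apply/smooth_atP; split; first exact: cvg_fst.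
apply: smooth_near_eq (fst_rep p) _.
by apply: (@smooth_near_lin _ _ _ fst) => x; exact: cvg_fst.
Qed.

Lemma smooth_at_snd (p : MN) : smooth_at (M := MN) (N := N) snd p.
Proof.
apply/smooth_atP; split; first exact: cvg_snd.
apply: smooth_near_eq (snd_rep p) _.
by apply: (@smooth_near_lin _ _ _ snd) => x; exact: cvg_snd.
Qed.

Lemma tmap_fst (p : MN) v : tmap (M := MN) (N := M) fst p v = v.1.
Proof.
have [_ d] := smooth_at_mdiff (smooth_at_fst p).
have dl : differentiable (fst : E * F -> E) (cphi (chart_at p) p).
  by apply: (@linear_differentiable _ _ _ fst) => x; exact: cvg_fst.
rewrite /tmap -deriveE// -(near_eq_derive v (fst_rep p)) deriveE//.
by rewrite (@diff_lin _ _ _ fst)// => x; exact: cvg_fst.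
Qed.

Lemma tmap_snd (p : MN) v : tmap (M := MN) (N := N) snd p v = v.2.
Proof.
have [_ d] := smooth_at_mdiff (smooth_at_snd p).
have dl : differentiable (snd : E * F -> F) (cphi (chart_at p) p).
  by apply: (@linear_differentiable _ _ _ snd) => x; exact: cvg_snd.
rewrite /tmap -deriveE// -(near_eq_derive v (snd_rep p)) deriveE//.
by rewrite (@diff_lin _ _ _ snd)// => x; exact: cvg_snd.
Qed.

Variables (f : Q -> M) (g : Q -> N) (p : Q).

Lemma smooth_at_pair : smooth_at f p -> smooth_at g p ->
  smooth_at (N := MN) (fun q => (f q, g q)) p.
Proof.
move=> /smooth_atP[cf sf] /smooth_atP[cg sg]; apply/smooth_atP; split.
  exact: cvg_pair.
exact: smooth_near_pair.
Qed.

Lemma mdiff_pair : mdiff f p -> mdiff g p ->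
  mdiff (N := MN) (fun q => (f q, g q)) p.
Proof.
move=> [cf df] [cg dg]; split; first exact: cvg_pair.
exact: differentiable_pair.
Qed.

Lemma tmap_pair v : mdiff f p -> mdiff g p ->
  tmap (N := MN) (fun q => (f q, g q)) p v = (tmap f p v, tmap g p v).
Proof.
move=> [cf df] [cg dg]; rewrite /tmap.
have -> : local_rep (N := MN) (fun q => (f q, g q)) p =
  fun x => (local_rep f p x, local_rep g p x) by [].
by rewrite diff_pair.
Qed.

End ProductMaps.

(** * Curves and their velocities *)

Section Curves.
Variables (R : realType) (E : normedModType R) (M : atlas_space E).

(** Differentiability is required at 0 only, since a lift obtained by pointwise fixed points has no
    known regularity elsewhere. *)
Definition curve (c : R -> M) (p : M) (v : E) : Prop :=
  [/\ c 0 = p, mdiff (M := flat_space R^o) c 0 &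
      tmap (M := flat_space R^o) c 0 1 = v].

Lemma curve_near (c : R -> M) p v (P : set M) :
  curve c p v -> (\forall q \near p, P q) -> \forall t \near (0 : R), P (c t).
Proof. by move=> [c0 [ctc _] _]; rewrite -c0 => /ctc. Qed.

Lemma curve_cst (p : M) : curve (fun=> p) p 0.
Proof.
split=> //; first exact/smooth_at_mdiff/(smooth_at_cst (M := flat_space R^o)).
exact: (tmap_cst (M := flat_space R^o)).
Qed.

(** The device behind the identities between tangent maps of groupoid operations: both sides are
    realised as velocities of the same germ. *)
Lemma curve_uniq (c d : R -> M) p v q w :
  (\forall t \near 0, c t = d t) -> curve c p v -> curve d q w -> v = w.
Proof.
move=> cd [_ dc <-] [_ _ <-].
exact: (@tmap_eq R R^o E (flat_space R^o) M).
Qed.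

End Curves.

Lemma curve_comp (R : realType) (E F : normedModType R)
    (M : atlas_space E) (N : atlas_space F) (c : R -> M) p v (f : M -> N) :
  mdiff f p -> curve c p v -> curve (f \o c) (f p) (tmap f p v).
Proof.
move=> df [c0 dc vc]; subst p; split=> //; first exact: mdiff_comp.
by rewrite tmap_comp// vc.
Qed.

Lemma curve_pair (R : realType) (E F : normedModType R)
    (M : atlas_space E) (N : atlas_space F) (c : R -> M) (d : R -> N) p q v w :
  curve c p v -> curve d q w ->
  curve (M := prod_space M N) (fun t => (c t, d t)) (p, q) (v, w).
Proof.
move=> [c0 dc vc] [d0 dd vd]; subst p q; split=> //; first exact: mdiff_pair.
by rewrite tmap_pair// vc vd.
Qed.

Section CurvesTheory.
Variables (R : realType) (E F : normedModType R).
Variables (M : atlas_space E) (N : atlas_space F).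

Lemma curve_chart (p : M) (c : R -> E) v : c 0 = cphi (chart_at p) p ->
  is_derive (0 : R) (1 : R) c v -> curve (cpsi (chart_at p) \o c) p v.
Proof.
move=> c0 dc.
have dfc : differentiable (c : R^o -> E) (0 : R^o).
  by apply/derivable1_diffP; exact: ex_derive.
have mc : mdiff (M := flat_space R^o) (N := flat_space E) c 0
  by exact/mdiff_flat.
have mp : mdiff (M := flat_space E) (cpsi (chart_at p)) (c 0).
  by rewrite c0; apply/smooth_at_mdiff/smooth_at_cpsi; exact: cphi_img.
split; first by rewrite /= c0 cphiK.
  exact: mdiff_comp mc mp.
rewrite (tmap_comp _ mc mp) c0 tmap_cpsi.
rewrite /tmap -[LHS]/('d (c : R^o -> E) (0 : R^o) (1 : R^o)) -deriveE//.
exact: derive_val.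
Qed.

(** [f'] only witnesses that some extension exists. The one selected by [xget] agrees with [f] along
    a curve lying in [S], which determines the value. *)
Lemma tmap_alongE (S : set M) (f f' : M -> N) p (c : R -> M) v :
  local_extension S f p f' -> curve c p v -> (\forall t \near 0, S (c t)) ->
  curve (f \o c) (f p) (tmap_along S f p v).
Proof.
move=> ext cc Sc; rewrite /tmap_along.
set f2 := xget _ _; have [sf2 ff2] : local_extension S f p f2.
  exact: (@xgetI _ f _ f').
have cf := curve_comp (smooth_at_mdiff sf2) cc.
have n0 := curve_near cc ff2.
case: cc => c0 _ _.
have e : \forall t \near (0 : R), f2 (c t) = f (c t).
  by apply: filterS2 n0 Sc => t /= H /H.
case: cf => e0 d0 v0.
have fp : f2 p = f p by have := nbhs_singleton e; rewrite c0.
split; first by rewrite /= c0.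
  exact: (mdiff_eq (M := flat_space R^o) (f := f2 \o c)).
by rewrite -v0; apply/esym; exact: (tmap_eq (M := flat_space R^o)).
Qed.

Lemma tmap_along_ext (S : set M) (f f' : M -> N) p (c : R -> M) v :
  local_extension S f p f' -> curve c p v -> (\forall t \near 0, S (c t)) ->
  tmap_along S f p v = tmap f' p v.
Proof.
move=> ext cc Sc; have h1 := tmap_alongE ext cc Sc.
case: ext => sf' ff'; have h2 := curve_comp (smooth_at_mdiff sf') cc.
apply: curve_uniq h1 h2; have n0 := curve_near cc ff'.
by apply: filterS2 n0 Sc => t /= H /H ->.
Qed.

End CurvesTheory.

Lemma curve_submersion_lift (R : realType) (E : normedModType R) m (M :
    atlas_space E)
    (N : atlas_space 'rV[R]_m) (f : M -> N) (p : M) v (d : R -> N) :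
  has_coords E -> submersion f -> curve d (f p) (tmap f p v) ->
  exists c, curve c p v /\ \forall t \near 0, f (c t) = d t.
Proof.
move=> cE [sf sur] cd; case: (cd) => d0 md vd.
have /smooth_atP[cf snf] := sf p.
pose q t := cphi (chart_at (f p)) (d t).
have sc : smooth_at (N := flat_space 'rV[R]_m) (cphi (chart_at (f p))) (f p).
  exact: smooth_at_cphi.
have [q0 mq vq] := curve_comp (smooth_at_mdiff sc) cd.
rewrite tmap_cphi components_id in vq.
have dq : is_derive (0 : R) (1 : R) q (tmap f p v).
  have /mdiff_flat h := mq; apply: DeriveDef; first exact/derivable1_diffP.
  by rewrite deriveE.
have [|c [c0 dc fc]] := curve_lift cE snf (sur p) _ dq.
  by rewrite local_repE /q d0.
have cc := curve_chart c0 dc.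
exists (cpsi (chart_at p) \o c); split=> //.
have nfp := near_cdom (chart_at_dom (f p)).
(* The lift gives an equality of chart images; charts are injective on their domains only, so both
   curves have to stay in the domain. *)
have n1 := curve_near (curve_comp (smooth_at_mdiff (sf p)) cc) nfp.
have n2 := curve_near cd nfp.
apply: filterS3 fc n1 n2 => t; rewrite /local_rep /q /= => H h1 h2.
by rewrite -(cphiK h1) H cphiK.
Qed.

(** * A smooth cut-off *)

Section Cutoff.
Variable R : realType.

(* The derivatives of the flat function [exp (- 1 / t)] stay in this family. *)
Definition flat_exp (p : {poly R}) (t : R) : R :=
  if 0 < t then p.[t^-1] * expR (- t^-1) else 0.

Lemma horner_bound (p : {poly R}) s : 1 <= s ->
  `|p.[s]| <= (\sum_(i < size p) `|p`_i|) * s ^+ size p.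
Proof.
move=> s1; rewrite horner_coef mulr_suml;
  apply: (le_trans (ler_norm_sum _ _ _)).
apply: ler_sum => i _; rewrite normrM ler_wpM2l// ger0_norm.
  by rewrite ler_weXn2l// ltnW.
by rewrite exprn_ge0// (le_trans ler01).
Qed.

(** With s = 1/t, the inequality exp(s) >= s^(n+2) / (n+2)! absorbs the polynomial, bounded by P
    s^n, and leaves a factor t^2. *)
Lemma flat_exp_bound (p : {poly R}) : exists C,
  \forall t \near (0 : R), `|flat_exp p t| <= C * `|t ^+ 2|.
Proof.
set n := size p; set P := \sum_(i < size p) `|p`_i|.
have P0 : 0 <= P by exact: sumr_ge0.
exists (P * (n.+2)`!%:R).
near=> t; rewrite /flat_exp; case: ifPn => [t0|_]; last first.
  by rewrite normr0 !mulr_ge0.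
have t1 : t <= 1.
  by apply: ltW; near: t; exact: lt_nbhsl ltr01.
have s1 : 1 <= t^-1 by rewrite invf_ge1.
have s0 : 0 < t^-1 by rewrite invr_gt0.
have t2 : 0 <= t ^+ 2 by rewrite exprn_ge0// ltW.
rewrite normrM (ger0_norm (expR_ge0 _)) (ger0_norm t2).
apply: (@le_trans _ _ (P * t^-1 ^+ n * expR (- t^-1))).
  by rewrite ler_wpM2r ?expR_ge0// horner_bound.
rewrite -!mulrA ler_wpM2l// expRN.
have h : t^-1 ^+ n.+2 / (n.+2)`!%:R <= expR t^-1.
  by apply: le_trans (expR_ge1Dxn n.+1 (ltW s0)); rewrite lerDr.
have f0 : 0 < (n.+2)`!%:R :> R by rewrite ltr0n fact_gt0.
rewrite ler_pdivrMr ?expR_gt0//.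
have -> : t^-1 ^+ n = t ^+ 2 * t^-1 ^+ n.+2.
  by rewrite -[n.+2]addn2 exprD mulrCA -exprMn divff ?gt_eqF// expr1n mulr1.
rewrite [leRHS]mulrAC [leRHS]mulrC ler_wpM2l//.
by move: h; rewrite ler_pdivrMr// mulrC.
Unshelve. all: by end_near. Qed.

Lemma flat_exp_derive (p : {poly R}) (t : R) :
  is_derive t (1 : R) (flat_exp p) (flat_exp ((p - p^`()) * 'X ^+ 2) t).
Proof.
have [t0|t0|->] := ltgtP t 0.
- rewrite {2}/flat_exp ltNge (ltW t0)/=.
  have nz : \forall s \near t, cst 0 s = flat_exp p s.
    have := lt_nbhsl t0; apply: filterS => s s0.
    by rewrite /flat_exp ltNge (ltW s0).
  exact: (near_eq_is_derive nz (is_derive_cst _ _ _)).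
- rewrite {2}/flat_exp t0.
  have np : \forall s \near t, (horner p \o (fun s => s^-1)) s *
    (expR \o (fun s => - s^-1)) s = flat_exp p s.
    have := lt_nbhsr t0; apply: filterS => s s0.
    by rewrite /flat_exp s0.
  have tn0 : t != 0 by rewrite gt_eqF.
  have dV : is_derive t (1 : R) (fun s : R => s^-1) (- t ^- 2).
    apply: DeriveDef; first exact: derivableV.
    by rewrite (deriveV (f := id) tn0 (@derivable_id _ _ t 1)) derive_id
      [_ *: _]mulr1.
  have dp := is_derive1_comp (is_derive_poly p t^-1) dV.
  have dN : is_derive t (1 : R) (fun s : R => - s^-1) (- - t ^- 2).
    exact: is_deriveN dV.
  have de := is_derive1_comp (g := fun s : R => - s^-1)
    (is_derive_expR (- t^-1)) dN.
  apply: (near_eq_is_derive np).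
  apply: (is_derive_eq (is_deriveM dp de)).
  rewrite hornerM hornerXn hornerD hornerN /= /GRing.scale /= exprVn; ring.
- rewrite {2}/flat_exp ltxx; have [C HC] := flat_exp_bound p.
  apply: (is_derive0_dom (g := fun t : R => t ^+ 2) _ _ HC).
    by rewrite expr0n.
  have := is_deriveX 2 (is_derive_id (0 : R) 1).
  by rewrite mulr0 scale0r.
Qed.

Lemma flat_exp_smooth (p : {poly R}) (t : R) :
  smooth_near (flat_exp p : R^o -> R^o) t.
Proof.
exists setT; split; first by split=> //; exact: openT.
move=> k; elim: k p => [|k IH] p.
  move=> x _; apply: differentiable_continuous; apply/derivable1_diffP.
  exact: (@ex_derive _ _ _ _ _ _ _ (flat_exp_derive p x)).
have df x : differentiable (flat_exp p : R^o -> R^o) x.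
  apply/derivable1_diffP.
  exact: (@ex_derive _ _ _ _ _ _ _ (flat_exp_derive p x)).
split=> [x _|v]; first exact: df.
have cv : Ck k setT (fun _ : R^o => v : R^o) by exact: Ck_cst.
apply: (Ck_eq openT) (Ck_scale openT cv (IH ((p - p^`()) * 'X ^+ 2))) => x _.
rewrite (deriveE _ (df x)) -[v in RHS]mulr1 -[v * 1]/(v *: (1 : R^o)) linearZ.
rewrite -(deriveE _ (df x)); congr (_ *: _); apply/esym.
exact: (@derive_val _ _ _ _ _ _ _ (flat_exp_derive p x)).
Qed.

(** The maximum norm is not smooth, so the flat function is applied to [r ^+ 2] minus the sum of
    squares [q]. Since [q] dominates the square of the norm, the cut-off vanishes where the norm
    reaches [r]. *)
Lemma cutoff_exists m (x0 : 'rV[R]_m) r : 0 < r ->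
  exists b : 'rV[R]_m -> R^o, [/\ forall x, smooth_near b x, b x0 = 1 &
    forall x, r <= `|x - x0| -> b x = 0].
Proof.
move=> r0; pose q (x : 'rV[R]_m) : R := \sum_i (x ord0 i - x0 ord0 i) ^+ 2.
have q0 x : 0 <= q x by apply: sumr_ge0 => i _; exact: sqr_ge0.
have qx0 : q x0 = 0 by rewrite /q big1// => i _; rewrite subrr expr0n.
have r2 : 0 < r ^+ 2 by rewrite exprn_gt0.
pose f (t : R) : R := flat_exp 1 (r ^+ 2 - t).
have f0 : 0 < f 0.
  by rewrite /f /flat_exp subr0 r2 hornerC mul1r expR_gt0.
exists (fun x => (f 0)^-1 * f (q x)); split=> [x||x rx].
- have sq : @smooth_near R 'rV[R]_m R^o (fun x => r ^+ 2 - q x) x.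
    have c y : smooth_near (fun x : 'rV[R]_m => y : R^o) x
      by exact: smooth_near_cst.
    have sc i : @smooth_near R 'rV[R]_m R^o (fun x => x ord0 i - x0 ord0 i) x.
      apply: smooth_near_add (c _).
      by apply: (@smooth_near_lin _ _ _ (coord_lin R i)) => y;
        exact: coord_continuous.
    have ss := smooth_near_sum (fun i => smooth_near_scale (sc i) (sc i)).
    apply: smooth_near_eq (smooth_near_add (c (r ^+ 2))
      (smooth_near_scale (c (-1)) ss)).
    by apply: filterE => y; rewrite [_ *: _]mulN1r.
  have := smooth_near_comp (has_coords_R R) sq (flat_exp_smooth 1 _).
  move=> /(smooth_near_scale (smooth_near_cst ((f 0)^-1 : R^o) x)).
  exact.
- by rewrite qx0 mulVf// gt_eqF.
- suff h : r ^+ 2 - q x <= 0 by rewrite {2}/f /flat_exp ltNge h mulr0.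
  rewrite subr_le0 -[q x]sqr_sqrtr// ler_sqr ?nnegrE ?sqrtr_ge0 ?(ltW r0)//.
  apply: le_trans rx _; apply: norm_rV_le => [|j]; first exact: sqrtr_ge0.
  rewrite !mxE -sqrtr_sqr ler_wsqrtr// /q (bigD1 j)//= lerDl.
  by apply: sumr_ge0 => i _; exact: sqr_ge0.
Qed.

End Cutoff.

(** * Invariant vector fields through curves *)

Section GroupoidCurves.
Variables (R : realType) (n m : nat) (G : lie_groupoid R n m).
Local Notation E := 'rV[R]_n.
Local Notation A := (arrows G).
Local Notation B := (base G).
Local Notation A2 := (prod_space A A).
Local Notation A3 := (prod_space (prod_space A A) A).

Lemma src_mdiff (g : A) : mdiff (src G) g.
Proof. by apply: smooth_at_mdiff; exact: (src_submersion G).1. Qed.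

Lemma tgt_mdiff (g : A) : mdiff (tgt G) g.
Proof. by apply: smooth_at_mdiff; exact: (tgt_submersion G).1. Qed.

Lemma src_lift (g : A) v (d : R -> B) : curve d (src G g) (tmap (src G) g v) ->
  exists c, curve c g v /\ \forall t \near 0, src G (c t) = d t.
Proof. exact: curve_submersion_lift (has_coords_rV R n) (src_submersion G). Qed.

Lemma src_fibre_curve (g : A) v : tmap (src G) g v = 0 ->
  exists c, curve c g v /\ \forall t \near 0, src G (c t) = src G g.
Proof.
move=> gv; apply: (@src_lift g v (fun=> src G g)).
by rewrite gv; exact: curve_cst.
Qed.

Lemma mul_extension (g h : A) : tgt G g = src G h ->
  exists F : A2 -> A, smooth_at F (g, h) /\
    \forall z \near (g, h), tgt G z.1 = src G z.2 -> F z = gmul G z.1 z.2.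
Proof. by move=> gh; have [F [sF FE]] := @gmul_smooth R n m G (g, h) gh;
  exists F. Qed.

Lemma ginv_unit (q : B) : ginv G (unit_at G q) = unit_at G q.
Proof.
have := mul_unit (ginv G (unit_at G q)).
by rewrite tgt_inv src_unit inv_mul tgt_unit => /esym.
Qed.

(** The base point [h] is general because two cases occur: units, for invariant fields, and [g]
    itself, for undoing a left translation. The conjunct [setT h] matches the set in [tleft] when
    all arrows are allowed. *)
Lemma left_extension (g h : A) : tgt G g = src G h ->
  exists f, local_extension (M := A) (N := A)
    [set h | setT h /\ src G h = tgt G g] (gmul G g) h f.
Proof.
move=> gh; have [F [sF FE]] := mul_extension gh.
have si : smooth_at (N := A2) (fun h' : A => (g, h')) h.
  by apply: smooth_at_pair; [exact: smooth_at_cst|exact: smooth_at_id].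
exists (fun h' => F (g, h')); split.
  have cc : has_coords (E * E)%type by apply: has_coords_pair;
    exact: has_coords_rV.
  exact: (smooth_at_comp (f := fun h' : A => (g, h') : A2) cc si).
by have := smooth_at_near si FE; apply: filterS => h' /= H [_ /esym].
Qed.

Lemma right_extension (g : A) : exists f, local_extension (M := A) (N := A)
  [set h | setT h /\ src G h = src G g] (fun h => gmul G (ginv G h) g)
  (unit_at G (src G g)) f.
Proof.
have gh : tgt G (ginv G (unit_at G (src G g))) = src G g.
  by rewrite tgt_inv src_unit.
have [F [sF FE]] := mul_extension gh.
have si : smooth_at (N := A2) (fun h' : A => (ginv G h', g))
  (unit_at G (src G g)).
  by apply: smooth_at_pair; [exact: ginv_smooth|exact: smooth_at_cst].
exists (fun h' => F (ginv G h', g)); split.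
  have cc : has_coords (E * E)%type by apply: has_coords_pair;
    exact: has_coords_rV.
  exact: (smooth_at_comp (f := fun h' : A => (ginv G h', g) : A2) cc si).
have := smooth_at_near si FE; apply: filterS => h' /= H [_ hg].
by apply: H; rewrite tgt_inv.
Qed.

Lemma tleft_curve (g : A) a (c : R -> A) : curve c (unit_at G (tgt G g)) a ->
  (\forall t \near 0, src G (c t) = tgt G g) ->
  curve (fun t => gmul G g (c t)) g (tleft setT G g a).
Proof.
move=> cc sc; have [|f ext] := @left_extension g (unit_at G (tgt G g)).
  by rewrite src_unit.
have := tmap_alongE ext cc; rewrite mul_unit; apply.
by apply: filterS sc => t.
Qed.

Lemma tright_curve (g : A) a (c : R -> A) : curve c (unit_at G (src G g)) a ->
  (\forall t \near 0, src G (c t) = src G g) ->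
  curve (fun t => gmul G (ginv G (c t)) g) g (tright_inv setT G g a).
Proof.
move=> cc sc; have [f ext] := right_extension g.
have := tmap_alongE ext cc; rewrite ginv_unit unit_mul; apply.
by apply: filterS sc => t.
Qed.

Lemma algebroid_curve (q : B) a : algebroid q a ->
  exists c, curve c (unit_at G q) a /\ \forall t \near 0, src G (c t) = q.
Proof. by move=> /src_fibre_curve; rewrite src_unit. Qed.

Lemma tmap_src_tleft (g : A) a : algebroid (tgt G g) a ->
  tmap (src G) g (tleft setT G g a) = 0.
Proof.
move=> /algebroid_curve[c [cc sc]].
have h := curve_comp (src_mdiff g) (tleft_curve cc sc).
apply: curve_uniq h (curve_cst (src G g)).
by apply: filterS sc => t st /=; rewrite src_mul.
Qed.

Lemma tmap_tgt_tleft (g : A) a : algebroid (tgt G g) a ->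
  tmap (tgt G) g (tleft setT G g a) = tmap (tgt G) (unit_at G (tgt G g)) a.
Proof.
move=> /algebroid_curve[c [cc sc]].
have h := curve_comp (tgt_mdiff g) (tleft_curve cc sc).
apply: curve_uniq h (curve_comp (tgt_mdiff _) cc).
by apply: filterS sc => t st /=; rewrite tgt_mul.
Qed.

Lemma tmap_src_tright (g : A) a : algebroid (src G g) a ->
  tmap (src G) g (tright_inv setT G g a) = tmap (tgt G) (unit_at G (src G g)) a.
Proof.
move=> /algebroid_curve[c [cc sc]].
have h := curve_comp (src_mdiff g) (tright_curve cc sc).
apply: curve_uniq h (curve_comp (tgt_mdiff _) cc).
by apply: filterS sc => t st /=; rewrite src_mul ?tgt_inv ?src_inv.
Qed.

Lemma tmap_tgt_tright (g : A) a : algebroid (src G g) a ->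
  tmap (tgt G) g (tright_inv setT G g a) = 0.
Proof.
move=> /algebroid_curve[c [cc sc]].
have h := curve_comp (tgt_mdiff g) (tright_curve cc sc).
apply: curve_uniq h (curve_cst (tgt G g)).
by apply: filterS sc => t st /=; rewrite tgt_mul ?tgt_inv.
Qed.

(** [f] extends left multiplication by the inverse of [g]. Its tangent map is linear on all of T_g
    G, so it can extend a form known only on the image of [tleft]. *)
Lemma tleft_inverse (g : A) : exists f : A -> A, forall a,
  algebroid (tgt G g) a -> tmap f g (tleft setT G g a) = a.
Proof.
have gg : tgt G (ginv G g) = src G g by rewrite tgt_inv.
have [f [sf fE]] := left_extension gg; exists f =>
  a /algebroid_curve[c [cc sc]].
have cg := tleft_curve cc sc.
have h := curve_comp (smooth_at_mdiff sf) cg.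
apply: curve_uniq h cc; have := curve_near cg fE.
apply: filterS2 sc => t sc /= ->.
  by rewrite gmulA// inv_mul -sc unit_mul.
by rewrite src_mul// tgt_inv.
Qed.

(** The section is the velocity of (r, c, d), with [c] in a source fibre and [d] a lift through the
    source map of the target of [c]. The lift exists with velocity [Y r] exactly because T beta(X) =
    T alpha(Y). Multiplying by (g, h, r) gives (g, hc, d). *)
Lemma prol_lfieldE (X : B -> E) (Y : A -> E) : is_prol_section X Y ->
  forall g h r : A, prolongation (g, h, r) ->
    prol_lfield X Y (g, h, r) = (0, lfield X h, Y r).
Proof.
move=> [[_ aX] _ XY] g h r [/= gh hr].
have [c [cc sc]] := algebroid_curve (aX (src G r)).
have hc := curve_comp (tgt_mdiff _) cc; rewrite tgt_unit XY in hc.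
have [d [cd sd]] := src_lift hc.
have [|f [sf fE]] := @left_extension h (unit_at G (src G r)).
  by rewrite src_unit.
have p1 := @smooth_at_fst R _ _ A2 A (r, unit_at G (src G r), r).
have p2 := @smooth_at_snd R _ _ A2 A (r, unit_at G (src G r), r).
have p11 := @smooth_at_snd R _ _ A A (r, unit_at G (src G r)).
have cE : has_coords (E * E)%type by apply: has_coords_pair;
  exact: has_coords_rV.
have p12 : smooth_at (M := A3) (N := A) (fun w => w.1.2)
  (r, unit_at G (src G r), r).
  exact: (smooth_at_comp (N := A2) cE p1 p11).
have ext : local_extension (M := A3) (N := A3)
    [set w | prolongation w /\ src (prolongation_ops G) w = tgt
      (prolongation_ops G) (g, h, r)]
    (gmul (prolongation_ops G) (g, h, r))
    (unit_at (prolongation_ops G) r) (fun w => (g, f w.1.2, w.2)).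
  split.
    apply: (@smooth_at_pair R _ _ _ A2 A A3) => //.
    apply: (@smooth_at_pair R _ _ _ A A A3); first exact: smooth_at_cst.
    exact: (smooth_at_comp (f := fun w : A3 => w.1.2) (has_coords_rV R n) p12
      sf).
  have := smooth_at_near p12 fE; apply: filterS => -[[w1 w2] w3] /= H
    [[/= e1 e2] e3].
  by rewrite H//; split=> //; rewrite hr -e1 e3.
have cw := curve_pair (curve_pair (curve_cst r) cc) cd.
have nw : \forall t \near (0 : R), [set w | prolongation w /\
    src (prolongation_ops G) w = tgt (prolongation_ops G) (g, h, r)]
      (r, c t, d t).
  by apply: filterS2 sc sd => t s1 s2; split.
have k1 := tmap_alongE ext cw nw.
rewrite -hr in cc sc.
have k2 := curve_pair (curve_pair (curve_cst g) (tleft_curve cc sc)) cd.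
rewrite /lfield /left_field.
have e := curve_uniq (M := A3) _ k1 k2.
by apply: e; exact: filterE.
Qed.

(** Inversion exchanges the outer entries: (g, c, d) becomes (d, c^-1, g), and its product with (g,
    h, r) is (d, c^-1 h, r). The minus sign in the definition of [right_field] then falls on Y and
    on the middle entry. *)
Lemma prol_rfieldE (X : B -> E) (Y : A -> E) : is_prol_section X Y ->
  forall g h r : A, prolongation (g, h, r) ->
    prol_rfield X Y (g, h, r) = (- Y g, rfield X h, 0).
Proof.
move=> [[_ aX] _ XY] g h r [/= gh hr].
have [c [cc sc]] := algebroid_curve (aX (src G g)).
have hc := curve_comp (tgt_mdiff _) cc; rewrite tgt_unit XY in hc.
have [d [cd sd]] := src_lift hc.
have [f [sf fE]] := right_extension h; rewrite -gh in sf fE.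
have p1 := @smooth_at_fst R _ _ A2 A (g, unit_at G (src G g), g).
have p2 := @smooth_at_snd R _ _ A2 A (g, unit_at G (src G g), g).
have p11 := @smooth_at_snd R _ _ A A (g, unit_at G (src G g)).
have cE : has_coords (E * E)%type by apply: has_coords_pair;
  exact: has_coords_rV.
have p12 : smooth_at (M := A3) (N := A) (fun w => w.1.2)
  (g, unit_at G (src G g), g).
  exact: (smooth_at_comp (N := A2) cE p1 p11).
have ext : local_extension (M := A3) (N := A3)
    [set w | prolongation w /\ src (prolongation_ops G) w = src
      (prolongation_ops G) (g, h, r)]
    (fun w => gmul (prolongation_ops G) (ginv (prolongation_ops G) w) (g, h, r))
    (unit_at (prolongation_ops G) g) (fun w => (w.2, f w.1.2, r)).
  split.
    apply: (@smooth_at_pair R _ _ _ A2 A A3); last exact: smooth_at_cst.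
    apply: (@smooth_at_pair R _ _ _ A A A3) => //.
    exact: (smooth_at_comp (f := fun w : A3 => w.1.2) (has_coords_rV R n) p12
      sf).
  have := smooth_at_near p12 fE; apply: filterS => -[[w1 w2] w3] /= H
    [[/= e1 e2] e3].
  by rewrite H//; split=> //; rewrite -e1 e3.
have cw := curve_pair (curve_pair (curve_cst g) cc) cd.
have nw : \forall t \near (0 : R), [set w | prolongation w /\
    src (prolongation_ops G) w = src (prolongation_ops G) (g, h, r)]
      (g, c t, d t).
  by apply: filterS2 sc sd => t s1 s2; split.
have k1 := tmap_alongE ext cw nw.
rewrite gh in cc sc.
have k2 := curve_pair (curve_pair cd (tright_curve cc sc)) (curve_cst r).
rewrite /rfield /right_field.
transitivity (- ((Y g, tright_inv setT G h (X (src G h)), 0) : E * E * E)).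
  have e := curve_uniq (M := A3) _ k1 k2.
  by congr (- _); apply: e; exact: filterE.
by congr (_, _, _); exact: oppr0.
Qed.

End GroupoidCurves.

(** * Smooth sections of the Lie algebroid *)

Section MatrixSmooth.
Variables (R : realType) (V : normedModType R).

Lemma smooth_near_bigsum (W : normedModType R) I (r : seq I) (P : pred I)
    (f : I -> V -> W) x : (forall i, smooth_near (f i) x) ->
  smooth_near (fun y => \sum_(i <- r | P i) f i y) x.
Proof.
move=> sf; elim: r => [|i r IH].
  apply: smooth_near_eq (smooth_near_cst 0 x).
  by apply: filterE => y; rewrite big_nil.
case Pi: (P i).
  apply: smooth_near_eq (smooth_near_add (sf i) IH).
  by apply: filterE => y; rewrite big_cons Pi.
apply: smooth_near_eq IH.
by apply: filterE => y; rewrite big_cons Pi.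
Qed.

Definition mx_smooth p q (F : V -> 'M[R]_(p, q)) (x : V) : Prop :=
  forall i j, @smooth_near R V R^o (fun y => F y i j) x.

Lemma smooth_near_mul (f g : V -> R^o) x : smooth_near f x -> smooth_near g x ->
  @smooth_near R V R^o (fun y => (f y : R) * (g y : R)) x.
Proof. exact: smooth_near_scale. Qed.

Lemma mx_smooth_cst p q (M : 'M[R]_(p, q)) x : mx_smooth (fun=> M) x.
Proof. by move=> i j; exact: smooth_near_cst. Qed.

Lemma mx_smooth_mul p q s (F : V -> 'M[R]_(p, q)) (H : V -> 'M[R]_(q, s)) x :
  mx_smooth F x -> mx_smooth H x -> mx_smooth (fun y => F y *m H y) x.
Proof.
move=> sF sH i j.
have h k := smooth_near_mul (sF i k) (sH k j).
apply: smooth_near_eq (smooth_near_sum h).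
by apply: filterE => y; rewrite mxE.
Qed.

Lemma det_smooth p (F : V -> 'M[R]_p) x : mx_smooth F x ->
  @smooth_near R V R^o (fun y => \det (F y)) x.
Proof.
move=> sF; rewrite /determinant.
apply: smooth_near_bigsum => s; apply: smooth_near_mul.
  exact: smooth_near_cst.
by apply: smooth_near_prod => i; exact: sF.
Qed.

Lemma adj_smooth p (F : V -> 'M[R]_p) x : mx_smooth F x ->
  mx_smooth (fun y => \adj (F y)) x.
Proof.
move=> sF i j.
apply: (@smooth_near_eq _ _ R^o (fun y =>
  (-1) ^+ (j + i) * \det (row' j (col' i (F y))))).
  by apply: filterE => y; rewrite mxE /cofactor.
apply: smooth_near_mul; first exact: smooth_near_cst.
apply: det_smooth => a b.
apply: (@smooth_near_eq _ _ R^o (fun y => F y (lift j a) (lift i b))).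
  by apply: filterE => y; rewrite !mxE.
exact: sF.
Qed.

Lemma rV_smooth q (F : V -> 'rV[R]_q) x : mx_smooth F x -> smooth_near F x.
Proof.
move=> sF; have d j : smooth_near (fun _ : V => 'e_j : 'rV[R]_q) x.
  exact: smooth_near_cst.
apply: smooth_near_eq (smooth_near_sum (fun j =>
  smooth_near_scale (sF ord0 j) (d j))).
by apply: filterE => y; rewrite -row_sum_delta.
Qed.

End MatrixSmooth.

(** * Extending a kernel vector of a submersion *)

Section KernelExtension.
Variables (R : realType) (n m : nat).

Lemma jacobian_smooth (f : 'rV[R]_n -> 'rV[R]_m) x : smooth_near f x ->
  mx_smooth (fun y => jacobian f y) x.
Proof.
move=> sf i j.
have c : continuous (coord_lin R j) by move=> v; exact: coord_continuous.
have h := smooth_near_comp (has_coords_rV R m)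
  (smooth_near_derive 'e_i sf) (smooth_near_lin (f := coord_lin R j) _ c).
apply: smooth_near_eq h.
have := smooth_near_nbhs sf; apply: filterS => y /smooth_near_diff dy.
by rewrite /= deriveE// /jacobian mxE.
Qed.

(* [w y = det (S A) a - a A adj (S A) S] with [A] the Jacobian of [f] at [y] and
   [S A = 1] at [y0]: then [w y A = 0] without inverting [S A]. *)
Lemma kernel_extension (f : 'rV[R]_n -> 'rV[R]_m) y0 a :
  differentiable f y0 -> (forall w, exists v, 'd f y0 v = w) -> 'd f y0 a = 0 ->
  exists w : 'rV[R]_n -> 'rV[R]_n, w y0 = a /\
    forall y, smooth_near f y -> smooth_near w y /\ 'd f y (w y) = 0.
Proof.
move=> df0 sur ka.
have dE y v : differentiable f y -> 'd f y v = v *m jacobian f y.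
  by move=> dy; rewrite -deriveEjacobian// deriveE.
have /choice [s Hs] : forall j : 'I_m, exists v, 'd f y0 v = delta_mx 0 j
  by move=> j.
pose S : 'M[R]_(m, n) := \matrix_j s j.
have S1 : S *m jacobian f y0 = 1%:M.
  by apply/row_matrixP => j; rewrite row_mul rowK -dE// Hs row1.
pose A y := jacobian f y.
pose w y : 'rV[R]_n := \det (S *m A y) *: a - a *m A y *m \adj (S *m A y) *m S.
exists w; split.
  by rewrite /w /A S1 det1 scale1r -dE// ka !mul0mx subr0.
move=> y sy; have dy := smooth_near_diff sy; split; last first.
  (* The adjugate times [S *m A y] is the scalar matrix of the determinant, so the two terms cancel
     whether or not that matrix is invertible. *)
  rewrite dE// /w mulmxBl -scalemxAl -!mulmxA mul_adj_mx mulmxA.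
  by rewrite mul_mx_scalar subrr.
have sA := jacobian_smooth sy.
have sSA := mx_smooth_mul (mx_smooth_cst S y) sA.
have h1 := smooth_near_scale (det_smooth sSA) (smooth_near_cst a y).
have h2 := mx_smooth_mul (mx_smooth_mul (mx_smooth_mul (mx_smooth_cst a y) sA)
  (adj_smooth sSA)) (mx_smooth_cst S y).
have h3 := smooth_near_scale (smooth_near_cst (-1 : R^o) y) (rV_smooth h2).
apply: smooth_near_eq (smooth_near_add h1 h3).
by apply: filterE => z; rewrite /w scaleN1r.
Qed.

End KernelExtension.

Section IntoFlat.
Variables (R : realType) (E F : normedModType R).
Variables (M : atlas_space E).

Lemma smooth_at_into_flat (f : M -> flat_space F) p :
  smooth_at f p <->
  @smooth_near R E F (f \o cpsi (chart_at p)) (cphi (chart_at p) p).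
Proof.
split=> [/smooth_atP[] //|sf]; apply/smooth_atP; split=> //.
apply: local_rep_continuous; first exact: nearW.
exact: (differentiable_continuous (smooth_near_diff sf)).
Qed.

End IntoFlat.

Section SmoothHelpers.
Variables (R : realType) (E F : normedModType R).
Variables (M : atlas_space E).

Lemma smooth_at_scale (f : M -> flat_space R^o) (g : M -> flat_space F) p :
  smooth_at f p -> smooth_at g p ->
  smooth_at (N := flat_space F) (fun q => (f q : R) *: (g q : F)) p.
Proof.
move=> /smooth_at_into_flat sf /smooth_at_into_flat sg.
by apply/smooth_at_into_flat; exact: smooth_near_scale sf sg.
Qed.

Lemma smooth_at_diff (E' : normedModType R) (f : E' -> F)
    (a b : M -> flat_space E') p : has_coords E' ->
  smooth_near f (a p) -> smooth_at a p -> smooth_at b p ->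
  smooth_at (N := flat_space F) (fun q => 'd f (a q) (b q)) p.
Proof.
move=> cE sf /smooth_at_into_flat sa /smooth_at_into_flat sb.
apply/smooth_at_into_flat.
by apply: (smooth_near_diff_comp cE _ sa sb); rewrite /= cphiK.
Qed.

(** Not immediate, since smoothness at [q] refers to the charts of index [q] and [f q]. Near [q] the
    map factors as [cphi] at [p], then [local_rep f p], then [cpsi] at [f p], each smooth. *)
Lemma smooth_at_nearby (N : atlas_space F) (f : M -> N) p :
  has_coords E -> has_coords F -> smooth_at f p ->
  \forall q \near p, smooth_at f q.
Proof.
move=> cE cF sf; have /smooth_atP[cf sr] := sf.
have n1 := near_cphi (chart_at_dom p) (smooth_near_nbhs sr).
have n2 := near_cdom (chart_at_dom p).
have n3 := cf _ (near_cdom (chart_at_dom (f p))).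
have n4 : \forall q \near p, \forall q' \near q,
  cdom (chart_at p) q' /\ cdom (chart_at (f p)) (f q').
  have : nbhs p [set q' | cdom (chart_at p) q' /\ cdom (chart_at (f p)) (f q')].
    exact: filterI.
  rewrite nbhsE => -[U [oU Up] HU]; apply: filterS
    (open_nbhs_nbhs (conj oU Up)).
  by move=> q Uq; apply: filterS HU _; exact: open_nbhs_nbhs.
apply: filterS3 n1 n2 n4 => q sq dq nq.
have [_ dfq] := nbhs_singleton nq.
have s1 : smooth_at (N := flat_space E) (cphi (chart_at p)) q
  by exact: smooth_at_cphi.
have s2 : smooth_at (M := flat_space E) (N := flat_space F) (local_rep f p)
  (cphi (chart_at p) q).
  exact/smooth_at_flat.
have e : local_rep f p (cphi (chart_at p) q) = cphi (chart_at (f p)) (f q).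
  by rewrite /local_rep /= cphiK.
have s3 : smooth_at (M := flat_space F) (cpsi (chart_at (f p)))
    (local_rep f p (cphi (chart_at p) q)).
  by rewrite e; apply: smooth_at_cpsi; exact: cphi_img.
have s12 := smooth_at_comp cE s1 s2.
apply: (smooth_at_eq _ (smooth_at_comp cF s12 s3)).
by apply: filterS nq => q' [d1 d2]; rewrite /local_rep /= !cphiK.
Qed.

End SmoothHelpers.

(* [flat_space (E * F)] and [prod_space (flat_space E) (flat_space F)] are not
   convertible, for lack of eta for pairs. *)
Section FlatPair.
Variables (R : realType) (E E1 E2 : normedModType R) (M : atlas_space E).
Variables (f : M -> flat_space E1) (g : M -> flat_space E2) (p : M).
Local Notation F := (flat_space (E1 * E2)%type).

Lemma smooth_at_flat_pair : smooth_at f p -> smooth_at g p ->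
  smooth_at (N := F) (fun q => (f q, g q)) p.
Proof.
move=> /smooth_at_into_flat sf /smooth_at_into_flat sg.
by apply/smooth_at_into_flat; exact: smooth_near_pair sf sg.
Qed.

Lemma mdiff_flat_pair : mdiff f p -> mdiff g p ->
  mdiff (N := F) (fun q => (f q, g q)) p.
Proof.
move=> [cf df] [cg dg]; split; first exact: (cvg_pair cf cg).
exact: (differentiable_pair df dg).
Qed.

Lemma tmap_flat_pair v : mdiff f p -> mdiff g p ->
  tmap (N := F) (fun q => (f q, g q)) p v = (tmap f p v, tmap g p v).
Proof.
move=> [_ df] [_ dg]; rewrite /tmap.
have -> : local_rep (N := F) (fun q => (f q, g q)) p =
  fun x => (local_rep f p x, local_rep g p x) by [].
by rewrite diff_pair.
Qed.

End FlatPair.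

Section Sections.
Variables (R : realType) (n m : nat) (G : lie_groupoid R n m).
Local Notation E := 'rV[R]_n.
Local Notation A := (arrows G).
Local Notation B := (base G).
Local Notation A2 := (prod_space A A).
Let cE := has_coords_rV R n.

(** Passes from one fixed chart around a unit to the chart of index the point itself, in which
    [algebroid] is expressed. *)
Lemma tmap_cpsi_src (e : A) y v : cimg (chart_at e) y ->
  cdom (chart_at (src G e)) (src G (cpsi (chart_at e) y)) ->
  smooth_near (local_rep (src G) e) y -> 'd (local_rep (src G) e) y v = 0 ->
  tmap (src G) (cpsi (chart_at e) y) (tmap (M := flat_space E)
    (cpsi (chart_at e)) y v) = 0.
Proof.
move=> iy dy sy fv.
have m1 := smooth_at_mdiff (smooth_at_cpsi iy).
have m2 := src_mdiff (cpsi (chart_at e) y).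
have m3 : mdiff (M := flat_space E) (N := flat_space 'rV[R]_m)
  (local_rep (src G) e) y.
  by apply/mdiff_flat; exact: smooth_near_diff.
have m4 : mdiff (M := flat_space 'rV[R]_m) (cpsi (chart_at (src G e)))
  (local_rep (src G) e y).
  by apply: smooth_at_mdiff; apply: smooth_at_cpsi; exact: cphi_img.
rewrite -(tmap_comp v m1 m2).
have n1 : \forall x \near y, (cpsi (chart_at (src G e)) \o local_rep (src G) e)
  x =
    (src G \o cpsi (chart_at e)) x.
  have := mdiff_near (mdiff_comp m1 m2) (near_cdom dy).
  by apply: filterS => x dx; rewrite /= /local_rep /= cphiK.
have e1 := tmap_eq (M := flat_space E) v n1 (mdiff_comp m3 m4).
have e2 := tmap_comp v m3 m4.
have e3 : tmap (M := flat_space E) (N := flat_space 'rV[R]_m)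
  (local_rep (src G) e) y v = 0.
  exact: fv.
by rewrite e3 tmap0 in e2; exact: etrans (esym e1) e2.
Qed.

(** A kernel field of the source map, built in one chart around the unit of [q0], is multiplied by a
    cut-off on the base and extended by 0. *)
Lemma algebroid_section_exists (q0 : B) a : algebroid q0 a ->
  exists X : B -> E, algebroid_section X /\ X q0 = a.
Proof.
move=> aa; pose e := unit_at G q0; pose c1 := chart_at e;
  pose c0 := chart_at (src G e).
have eq0 : src G e = q0 by exact: src_unit.
pose f := local_rep (src G) e; pose y (q : B) := cphi c1 (unit_at G q).
have /smooth_atP[_ sf] := (src_submersion G).1 e.
have [w [wa wk]] := kernel_extension (smooth_near_diff sf)
  ((src_submersion G).2 e) aa.
(* The points where the chart formula is meaningful and smooth; they form an open set. *)
pose good q := [/\ cdom c0 q, cdom c1 (unit_at G q) & smooth_near f (y q)].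
have ucont q P : (\forall g \near unit_at G q, P g) ->
  \forall q' \near q, P (unit_at G q').
  exact: (smooth_at_near (@unit_smooth R n m G q)).
have good_near q : good q -> \forall q' \near q, good q'.
  move=> [d0 d1 s1].
  have n1 := ucont q _ (near_cdom d1).
  have n2 := ucont q _ (near_cphi d1 (smooth_near_nbhs s1)).
  by apply: filterS3 (near_cdom d0) n1 n2 => q' ? ? ?; split.
have good0 : good q0.
  split; [by rewrite /c0 eq0; exact: chart_at_dom|exact: chart_at_dom|exact:
    sf].
pose x0 := cphi c0 q0.
have d00 : cdom c0 q0 by case: good0.
have : \forall x \near x0, cimg c0 x /\ good (cpsi c0 x).
  have ni := near_cimg (cphi_img d00).
  by have := near_cpsi d00 (good_near _ good0); apply: filterS2 ni.
(* Halving the radius puts a closed ball, hence a compact one, inside the good region. Its image [K]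
   is closed because the base is Hausdorff. *)
move=> /nbhs_normP[d /= dpos Hd]; pose r := d / 2.
have r0 : 0 < r by exact: divr_gt0.
have rd : r < d by rewrite ltr_pdivrMr// ltr_pMr// ltr1n.
pose D := [set x : 'rV[R]_m | `|x - x0| <= r]; pose K := cpsi c0 @` D.
have DI x : D x -> cimg c0 x /\ good (cpsi c0 x).
  by move=> Dx; apply: Hd; rewrite /= distrC; exact: le_lt_trans Dx rd.
have cD : compact D.
  apply: bounded_closed_compact.
    exists (`|x0| + r); split; first exact: num_real.
    move=> s rs x Dx; apply: le_trans (ltW rs).
    rewrite -(subrK x0 x) (le_trans (ler_normD _ _))// addrC lerD2l; exact: Dx.
  apply: (@closed_comp _ _ (fun x : 'rV[R]_m => `|x - x0|) [set s :
    R | s <= r]).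
    move=> x _; apply: (@continuous_comp _ _ _ (fun x => x - x0)).
      by apply: continuousB; [exact: cvg_id|exact: cst_continuous].
    exact: norm_continuous.
  exact: closed_le.
have cK : closed K.
  apply: compact_closed; first exact: (base_manifold G).1.
  apply: continuous_compact cD; apply: continuous_in_subspaceT =>
    x /set_mem/DI[ix _].
  exact: cpsi_continuous.
have [b [sb b1 b0]] := cutoff_exists x0 r0.
pose W (q : B) : E := b (cphi c0 q) *: w (y q).
pose X (q : B) : E := if `[< good q >] then
  tmap (M := flat_space E) (cpsi c1) (y q) (W q) else 0.
have Xgood q : good q -> X q = tmap (M := flat_space E) (cpsi c1) (y q) (W q).
  by move=> gq; rewrite /X; case: asboolP.
exists X; split; last first.
  by rewrite Xgood// /W b1 scale1r wa tmap_cpsi.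
split=> [q1|q]; last first.
  rewrite /algebroid /=; have [gq|/asboolPn/negbTE ngq] := pselect (good q);
    last first.
    by rewrite /X ngq tmap0.
  have [d0 d1 s1] := gq; rewrite Xgood//.
  have {1}-> : unit_at G q = cpsi c1 (y q) by rewrite cphiK.
  apply: tmap_cpsi_src => //; first exact: cphi_img.
    by rewrite cphiK// src_unit.
  by rewrite /W linearZ /= (wk _ s1).2 scaler0.
(* At a good point the formula holds nearby. Any other point lies outside the closed set [K], and
   off [K] the field is 0, either by default or through the cut-off. *)
have [gq1|ngq1] := pselect (good q1).
  have [d0 d1 s1] := gq1.
  pose c := chart_at (unit_at G q1).
  have sy : smooth_at (N := flat_space E) y q1.
    exact: (smooth_at_comp cE (@unit_smooth R n m G q1) (smooth_at_cphi d1)).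
  have sT : smooth_near (cphi c \o cpsi c1) (y q1).
    by apply: transition_smooth; [exact: cphi_img|rewrite cphiK//;
      exact: chart_at_dom].
  have sw : smooth_at (N := flat_space E) (fun q => w (y q)) q1.
    apply: (smooth_at_comp (N := flat_space E) (g :=
      (w : flat_space E -> flat_space E)) cE sy).
    by apply/smooth_at_flat; exact: (wk _ s1).1.
  have sb' : smooth_at (N := flat_space R^o) (fun q => b (cphi c0 q)) q1.
    apply: (smooth_at_comp (N := flat_space 'rV[R]_m) (Q := flat_space R^o)
      (g := b) (has_coords_rV R m) (smooth_at_cphi d0)).
    exact/smooth_at_flat.
  (* In the chart at the unit of [q1], the components of [X] are the differential of the transition
     map at [y q], applied to [W q]. *)
  apply: smooth_at_eq (smooth_at_diff cE sT sy (smooth_at_scale sb' sw)).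
  have nc := ucont q1 _ (near_cdom (chart_at_dom (unit_at G q1))).
  apply: filterS2 (good_near _ gq1) nc => q gq dc; have [_ d1q _] := gq.
  rewrite Xgood// -tmap_cphi.
  have i1 : cimg c1 (y q) by exact: cphi_img.
  have m1 := smooth_at_mdiff (smooth_at_cpsi i1).
  have m2 : mdiff (N := flat_space E) (cphi c) (cpsi c1 (y q)).
    by rewrite /y cphiK//; apply: smooth_at_mdiff; exact: smooth_at_cphi.
  have := tmap_comp (W q) m1 m2.
  by rewrite {4}/y cphiK// => <-.
have nK : ~ K q1 by move=> [x Dx xq]; apply: ngq1; rewrite -xq;
  exact: (DI _ Dx).2.
have n1 : \forall q \near q1, ~ K q.
  by apply: open_nbhs_nbhs; split=> //; exact: closed_openC.
apply: smooth_at_eq (smooth_at_cst (N := flat_space E) 0 q1).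
apply: filterS n1 => q nKq; suff -> : X q = 0 by rewrite /components linear0.
rewrite /X; case: asboolP => // -[d0 _ _].
rewrite /W b0 ?scale0r ?tmap0//; rewrite leNgt; apply/negP => h; apply: nKq.
by exists (cphi c0 q); [exact: ltW|rewrite cphiK].
Qed.

(** Common to both kinds of invariant field: [Y] is the derivative of [F] in its second argument at
    a moving unit. In the charts at [p0] this is the differential of one fixed smooth map on the
    vector (0, [v g]), so smoothness in [g] follows. *)
Lemma smooth_field_at (F : A2 -> A) (f : A -> B) (X : B -> E) (Y : A -> E)
    (g0 : A) :
  smooth_at f g0 -> algebroid_section X -> smooth_at F (g0, unit_at G (f g0)) ->
  (\forall g \near g0, F (g, unit_at G (f g)) = g) ->
  (\forall g \near g0, Y g =
    tmap (N := A) (fun h : A => F (g, h)) (unit_at G (f g)) (X (f g))) ->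
  smooth_at (N := flat_space E) (fun g => components g0 g (Y g)) g0.
Proof.
move=> sf [sX _] sF FE YE.
pose u g := unit_at G (f g); pose p0 : A2 := (g0, u g0).
have cEE : has_coords (E * E)%type by exact: has_coords_pair.
have su : smooth_at u g0 by exact: (smooth_at_comp (has_coords_rV R m) sf
  (@unit_smooth R n m G (f g0))).
have Fp0 : F p0 = g0 by exact: nbhs_singleton FE.
have /smooth_atP[_ srF] := sF; rewrite -/p0 in srF.
pose a g : E * E := (cphi (chart_at g0) g, cphi (chart_at (u g0)) (u g)).
pose v g : E := components (u g0) (u g) (X (f g)).
have sa : smooth_at (N := flat_space (E * E)%type) a g0.
  have s1 := smooth_at_cphi (chart_at_dom g0).
  have s2 := smooth_at_comp cE su (smooth_at_cphi (chart_at_dom (u g0))).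
  exact: (smooth_at_flat_pair s1 s2).
have sv : smooth_at (N := flat_space E) v g0.
  exact: (smooth_at_comp (has_coords_rV R m) sf (sX (f g0))).
have sb : smooth_at (N := flat_space (E * E)%type) (fun g => (0, v g) : E * E)
  g0.
  exact: (smooth_at_flat_pair (smooth_at_cst (N := flat_space E) 0 g0) sv).
have := smooth_at_diff cEE (p := g0) (f := local_rep F p0) (a := a)
  (b := fun g => (0, v g)) srF sa sb.
apply: smooth_at_eq.
have spair : smooth_at (N := A2) (fun g : A => (g, u g)) g0.
  exact: smooth_at_pair (smooth_at_id g0) su.
near=> g.
have dg : cdom (chart_at g0) g by near: g; exact: near_cdom.
have du : cdom (chart_at (u g0)) (u g).
  by near: g; apply: (smooth_at_near su); exact: near_cdom.
have Fg : F (g, u g) = g by near: g.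
have sFg : smooth_at F (g, u g).
  by near: g; apply: (smooth_at_near spair); exact: smooth_at_nearby.
have sr : smooth_near (local_rep F p0) (a g).
  near: g; exact: (smooth_at_near sa (smooth_near_nbhs srF)).
have -> : Y g = tmap (N := A) (fun h : A => F (g, h)) (u g) (X (f g))
  by near: g.
(* For frozen [g], the chart reading of h |-> (g, h); its velocity has zero first component. *)
pose Phi (h : A) : E * E := (cphi (chart_at g0) g, cphi (chart_at (u g0)) h).
have m0 := smooth_at_mdiff (smooth_at_cphi du).
have mc : mdiff (N := flat_space E) (fun _ : A => cphi (chart_at g0) g) (u g).
  by apply: smooth_at_mdiff; exact: smooth_at_cst.
have mPhi : mdiff (N := flat_space (E * E)%type) Phi (u g)
  by exact: (mdiff_flat_pair mc m0).
have tPhi : tmap (N := flat_space (E * E)%type) Phi (u g) (X (f g)) = (0, v g).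
  by rewrite (tmap_flat_pair _ mc m0) tmap_cst.
have mr : mdiff (M := flat_space (E * E)%type) (N := flat_space E)
  (local_rep F p0) (Phi (u g)).
  by apply/mdiff_flat; exact: smooth_near_diff.
have si : smooth_at (N := A2) (fun h : A => (g, h)) (u g).
  exact: smooth_at_pair (smooth_at_cst _ _) (smooth_at_id _).
have mF : mdiff (N := A) (fun h : A => F (g, h)) (u g).
  apply: smooth_at_mdiff.
  exact: (smooth_at_comp (f := fun h : A => (g, h) : A2) cEE si).
have mcF : mdiff (N := flat_space E) (cphi (chart_at g0)) (F (g, u g)).
  by rewrite Fg; apply: smooth_at_mdiff; exact: smooth_at_cphi.
have e1 := tmap_comp (X (f g)) mPhi mr.
have e2 := tmap_comp (X (f g)) mF mcF.
rewrite tPhi in e1.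
transitivity (tmap (N := flat_space E) (local_rep F p0 \o Phi) (u g) (X (f g))).
  exact: esym e1.
rewrite -tmap_cphi; rewrite Fg in e2; rewrite -e2; apply: tmap_eq.
  have := near_cdom du; apply: filterS => h dh.
  by rewrite /local_rep /= Fp0 !cphiK.
exact: mdiff_comp mPhi mr.
Unshelve. all: by end_near. Qed.
End Sections.

(** * Invariant fields as sections over the prolongation *)

Section ProlongationSections.
Variables (R : realType) (n m : nat) (G : lie_groupoid R n m).
Local Notation E := 'rV[R]_n.
Local Notation A := (arrows G).
Local Notation B := (base G).
Local Notation A2 := (prod_space A A).
Let cE := has_coords_rV R n.
Let cEE : has_coords (E * E)%type := has_coords_pair cE cE.

Lemma algebroid_section0 : algebroid_section (fun _ : B => 0 : E).
Proof.
split=> [q|q]; last by rewrite /algebroid /= tmap0.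
apply: smooth_at_eq (smooth_at_cst (N := flat_space E) 0 q).
by apply: filterE => q'; rewrite /components linear0.
Qed.

Lemma smooth_lfield (X : B -> E) : algebroid_section X ->
  smooth_field (M := A) (lfield X).
Proof.
move=> sX g0; have gg : tgt G g0 = src G (unit_at G (tgt G g0))
  by rewrite src_unit.
have [F [sF FE]] := mul_extension gg.
have stgt := (tgt_submersion G).1 g0.
have su : smooth_at (N := A2) (fun g : A => (g, unit_at G (tgt G g))) g0.
  apply: smooth_at_pair; first exact: smooth_at_id.
  exact: (smooth_at_comp (has_coords_rV R m) stgt
    (@unit_smooth R n m G (tgt G g0))).
apply: (smooth_field_at stgt sX sF).
  have := smooth_at_near su FE; apply: filterS => g /= ->;
    first exact: mul_unit.
  by rewrite src_unit.
(* For each [g] near [g0], [F] has to agree with the multiplication on a neighbourhood of the unit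
   in the source fibre, not just at the unit. *)
have n1 := smooth_at_near su (nbhs_interior FE).
have n2 := smooth_at_near su (smooth_at_nearby cEE cE sF).
apply: filterS2 n1 n2 => g Fg sFg.
have [c [cc sc]] := algebroid_curve (sX.2 (tgt G g)).
have si : smooth_at (N := A2) (fun h : A => (g, h)) (unit_at G (tgt G g)).
  exact: smooth_at_pair (smooth_at_cst _ _) (smooth_at_id _).
apply: (tmap_along_ext _ cc); last by apply: filterS sc.
split; first exact: (smooth_at_comp (f := fun h : A => (g, h) : A2) cEE si).
by have := smooth_at_near si Fg; apply: filterS => h /= H [_ /esym].
Qed.

(** The swap [sw] turns the local multiplication into (g, h) |-> h^-1 g, putting the moving arrow
    first as [smooth_field_at] expects. *)
Lemma smooth_rfieldN (X : B -> E) : algebroid_section X ->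
  smooth_field (M := A) (fun g => tright_inv setT G g (X (src G g))).
Proof.
move=> sX g0; have gg : tgt G (ginv G (unit_at G (src G g0))) = src G g0.
  by rewrite tgt_inv src_unit.
have [F [sF FE]] := mul_extension gg.
have ssrc := (src_submersion G).1 g0.
pose sw (z : A2) : A2 := (ginv G z.2, z.1).
have ssw z : smooth_at (N := A2) sw z.
  apply: smooth_at_pair; last exact: smooth_at_fst.
  exact: (smooth_at_comp (M := A2) cE (@smooth_at_snd R _ _ A A z)
    (@ginv_smooth R n m G z.2)).
have su : smooth_at (N := A2) (fun g : A => (g, unit_at G (src G g))) g0.
  apply: smooth_at_pair; first exact: smooth_at_id.
  exact: (smooth_at_comp (has_coords_rV R m) ssrc
    (@unit_smooth R n m G (src G g0))).
have ssu := smooth_at_comp cEE su (ssw _).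
apply: (smooth_field_at (F := F \o sw) ssrc sX).
- exact: (smooth_at_comp cEE (ssw (g0, unit_at G (src G g0))) sF).
- have := smooth_at_near ssu FE; apply: filterS => g /= ->.
    by rewrite ginv_unit unit_mul.
  by rewrite tgt_inv src_unit.
have n1 := smooth_at_near ssu (nbhs_interior FE).
have n2 := smooth_at_near ssu (smooth_at_nearby cEE cE sF).
apply: filterS2 n1 n2 => g Fg sFg.
have [c [cc sc]] := algebroid_curve (sX.2 (src G g)).
have si : smooth_at (N := A2) (fun h : A => (ginv G h, g))
  (unit_at G (src G g)).
  exact: smooth_at_pair (@ginv_smooth R n m G _) (smooth_at_cst _ _).
apply: (tmap_along_ext _ cc); last by apply: filterS sc.
split; first exact: (smooth_at_comp (f := fun h : A => (ginv G h, g) : A2) cEE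
  si).
have := smooth_at_near si Fg; apply: filterS => h /= H [_ hg].
by apply: H; rewrite tgt_inv.
Qed.

Lemma prol_section_lfield (X : B -> E) : algebroid_section X ->
  is_prol_section (fun=> 0) (lfield X).
Proof.
move=> sX; split; [exact: algebroid_section0|exact: smooth_lfield|move=> g].
by rewrite tmap0 tmap_src_tleft//; exact: sX.2.
Qed.

Lemma prol_section_rfield (X : B -> E) : algebroid_section X ->
  is_prol_section X (fun g => tright_inv setT G g (X (src G g))).
Proof.
move=> sX; split=> //; [exact: smooth_rfieldN|move=> g].
by rewrite tmap_src_tright//; exact: sX.2.
Qed.

End ProlongationSections.

(** * Tangent vectors of the composable pairs *)

Section Dynamics.
Variables (R : realType) (n m : nat) (G : lie_groupoid R n m).
Local Notation E := 'rV[R]_n.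
Local Notation A := (arrows G).
Local Notation B := (base G).
Local Notation A2 := (prod_space A A).
Local Notation A3 := (prod_space (prod_space A A) A).
Let cE := has_coords_rV R n.

Lemma tmap_incl_G2 (z : A2) u : tmap (N := A3) (@incl_G2 R n m G) z u =
    (u.1, u.1, u.2).
Proof.
have m1 := smooth_at_mdiff (@smooth_at_fst R _ _ A A z).
have m2 := smooth_at_mdiff (@smooth_at_snd R _ _ A A z).
have h := tmap_pair u (mdiff_pair m1 m1) m2.
by rewrite (tmap_pair u m1 m1) tmap_fst tmap_snd in h.
Qed.

Lemma line_curve (g : A) v : exists c : R -> A, curve c g v.
Proof.
exists (cpsi (chart_at g) \o fun t => cphi (chart_at g) g + t *: v).
apply: curve_chart; first by rewrite scale0r addr0.
have := is_deriveD (is_derive_cst (cphi (chart_at g) g) (0 : R) 1)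
  (is_derive_line v 0).
by rewrite add0r.
Qed.

(** The first arrow moves freely; its target is then lifted through the source submersion with the
    prescribed velocity. *)
Lemma G2_curve (z : A2) u : G2 z -> tangent_G2 z u ->
  exists c : R -> A2, curve c z u /\ \forall t \near 0, G2 (c t).
Proof.
case: z u => [g h] [v w] /= gh tu; have [c cc] := line_curve g v.
have ct := curve_comp (tgt_mdiff g) cc; rewrite tu gh in ct.
have [d [cd dc]] := src_lift ct.
exists (fun t => (c t, d t)); split; first exact: curve_pair.
by apply: filterS dc => t /= e; exact: esym.
Qed.

Lemma tmap_along_G2 (L L' : A2 -> flat_space R^o) (z : A2) u : G2 z ->
  tangent_G2 z u -> local_extension (@G2 R n m G) L z L' ->
  tmap_along (@G2 R n m G) L z u = tmap L' z u.
Proof.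
move=> Gz tu ext; have [c [cc Gc]] := G2_curve Gz tu.
exact: tmap_along_ext ext cc Gc.
Qed.

Lemma D12E (f : A2 -> R^o) g h v w :
  tmap (N := flat_space R^o) f (g, h) (v, w) = D1 f g h v + D2 f g h w.
Proof.
rewrite /D1 /D2 -tmapD; congr (tmap _ _ _).
by congr (_, _); rewrite /= ?addr0 ?add0r.
Qed.

End Dynamics.

(** * Dynamics and Euler-Lagrange equations *)

Section EulerLagrange.
Variables (R : realType) (n m : nat) (G : lie_groupoid R n m).
Local Notation E := 'rV[R]_n.
Local Notation A := (arrows G).
Local Notation B := (base G).
Local Notation A2 := (prod_space A A).
Local Notation A3 := (prod_space (prod_space A A) A).

Lemma D10 (f : A2 -> R^o) g h : D1 f g h 0 = 0.
Proof. exact: (tmap0 (N := flat_space R^o) f (g, h)). Qed.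

Lemma D20 (f : A2 -> R^o) g h : D2 f g h 0 = 0.
Proof. exact: (tmap0 (N := flat_space R^o) f (g, h)). Qed.

Lemma D1_linear (f : A2 -> R^o) g h c u v :
  D1 f g h (c *: u + v) = c * D1 f g h u + D1 f g h v.
Proof.
rewrite /D1 -[c * _]/(c *: (_ : R^o)) -tmapZ -tmapD; congr (tmap _ _ _).
by congr (_, _); rewrite /= scaler0 addr0.
Qed.

Lemma D2_linear (f : A2 -> R^o) g h c u v :
  D2 f g h (c *: u + v) = c * D2 f g h u + D2 f g h v.
Proof.
rewrite /D2 -[c * _]/(c *: (_ : R^o)) -tmapZ -tmapD; congr (tmap _ _ _).
by congr (_, _); rewrite /= scaler0 addr0.
Qed.

Lemma tright_linear (g : A) c u v :
  tright_inv setT G g (c *: u + v) = c *: tright_inv setT G g u + tright_inv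
    setT G g v.
Proof. by rewrite /tright_inv /tmap_along tmapD tmapZ. Qed.

Lemma covector0 (z : A3) mu : covector z mu -> mu 0 = 0.
Proof.
move=> cmu; have t0 : tangent_prolongation z (0 : E * E * E).
  by split; rewrite /= !tmap0.
have := cmu 1 0 0 t0 t0; rewrite scaler0 addr0 mul1r => /eqP.
by rewrite -subr_eq0 opprD addrA subrr sub0r oppr_eq0 => /eqP.
Qed.

Lemma covectorD (z : A3) mu u v : covector z mu ->
  tangent_prolongation z u -> tangent_prolongation z v ->
  mu (u + v) = mu u + mu v.
Proof. by move=> cmu tu tv; have := cmu 1 u v tu tv; rewrite scale1r mul1r. Qed.

Lemma covectorN (z : A3) mu u : covector z mu -> tangent_prolongation z u ->
  mu (- u) = - mu u.
Proof.
move=> cmu tu; have t0 : tangent_prolongation z (0 : E * E * E).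
  by split; rewrite /= !tmap0.
by have := cmu (-1) u 0 tu t0; rewrite scaleN1r addr0 mulN1r (covector0 cmu)
  addr0.
Qed.

Variables (L : A2 -> R^o) (N : nat) (g : nat -> A) (Le : nat -> A2 -> R^o).
Hypothesis G2g : forall k, (1 <= k < N)%N -> G2 (g k, g k.+1).
Hypothesis LeL : forall k, (1 <= k < N)%N ->
  local_extension (N := flat_space R^o) (@G2 R n m G) L (g k, g k.+1) (Le k).

Let tg k : (1 <= k < N)%N -> tgt G (g k) = src G (g k.+1).
Proof. exact: G2g. Qed.

Lemma Sigma_eval mu k v w : (1 <= k < N)%N -> in_Sigma L (g k, g k.+1) mu ->
  tmap (tgt G) (g k) v = tmap (src G) (g k.+1) w ->
  mu (v, v, w) = D1 (Le k) (g k) (g k.+1) v + D2 (Le k) (g k) (g k.+1) w.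
Proof.
move=> kN [_ S] vw; have := S (v, w) vw; rewrite tmap_incl_G2 => ->.
by rewrite -D12E; apply: tmap_along_G2 (LeL kN) => //; exact: G2g.
Qed.

Lemma dynamics_EL gam k a : second_order_dynamics L N g gam ->
  (1 <= k)%N -> (k.+2 < N)%N -> algebroid (tgt G (g k.+1)) a ->
  0 = D1 (Le k.+1) (g k.+1) (g k.+2) (tleft setT G (g k.+1) a)
      + D2 (Le k) (g k) (g k.+1) (tleft setT G (g k.+1) a)
      + (D1 (Le k.+2) (g k.+2) (g k.+3) (tright_inv setT G (g k.+2) a)
         + D2 (Le k.+1) (g k.+1) (g k.+2) (tright_inv setT G (g k.+2) a)).
Proof.
move=> [S D] k1 kN aa.
have K0 : (1 <= k < N)%N by lia.
have K1 : (1 <= k.+1 < N)%N by lia.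
have K2 : (1 <= k.+2 < N)%N by lia.
have [X [sX Xa]] := algebroid_section_exists aa.
set xi := tleft setT G (g k.+1) a; set eta := tright_inv setT G (g k.+2) a.
have aa' : algebroid (src G (g k.+2)) a by rewrite -tg.
have P0 : prolongation (g k, g k, g k.+1) by split=> //=; exact: tg.
have P1 : prolongation (g k.+1, g k.+1, g k.+2) by split=> //=; exact: tg.
have P2 : prolongation (g k.+2, g k.+2, g k.+3) by split=> //=; exact: tg.
have K1' : (2 <= k.+1 < N)%N by lia.
have K2' : (2 <= k.+2 < N)%N by lia.
have e1 := D k.+1 K1' _ _ (prol_section_lfield sX).
have e2 := D k.+2 K2' _ _ (prol_section_rfield sX).
rewrite (prol_lfieldE (prol_section_lfield sX) P0)
  (prol_rfieldE (prol_section_lfield sX) P1) in e1.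
rewrite (prol_lfieldE (prol_section_rfield sX) P1)
  (prol_rfieldE (prol_section_rfield sX) P2) in e2.
have l0 h : lfield (fun _ : B => 0 : E) h = 0
  by rewrite /lfield /left_field /tleft /tmap_along tmap0.
have r0 h : rfield (fun _ : B => 0 : E) h = 0.
  by rewrite /rfield /right_field /tright_inv /tmap_along tmap0 oppr0.
have lX : lfield X (g k.+1) = xi by rewrite /lfield /left_field Xa.
have rX : rfield X (g k.+2) = - eta by rewrite /rfield /right_field -tg// Xa.
rewrite l0 r0 lX /= in e1; rewrite rX lX -tg// Xa -/eta /= in e2.
have sxi : tmap (src G) (g k.+1) xi = 0 by exact: tmap_src_tleft.
have txi : tmap (tgt G) (g k.+1) xi = tmap (src G) (g k.+2) eta.
  by rewrite (tmap_tgt_tleft aa) (tmap_src_tright aa') (tg K1).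
have teta : tmap (tgt G) (g k.+2) eta = 0 by exact: tmap_tgt_tright.
clearbody xi eta.
have h0 : tmap (tgt G) (g k) 0 = tmap (src G) (g k.+1) xi by rewrite sxi tmap0.
have h2 : tmap (tgt G) (g k.+2) eta = tmap (src G) (g k.+3) 0
  by rewrite teta tmap0.
have S0 := Sigma_eval K0 (S k K0) h0; rewrite D10 add0r in S0.
have S1 := Sigma_eval K1 (S k.+1 K1) txi.
have S2 := Sigma_eval K2 (S k.+2 K2) h2; rewrite D20 addr0 in S2.
have c1 := (S k.+1 K1).1; have c2 := (S k.+2 K2).1.
have t1 : tangent_prolongation (incl_G2 (g k.+1, g k.+2)) (xi, 0, 0).
  by split=> /=; rewrite ?sxi !tmap0.
have t2 : tangent_prolongation (incl_G2 (g k.+1, g k.+2)) (0, xi, eta).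
  by split; [rewrite /= tmap0 sxi|exact: txi].
have t3 : tangent_prolongation (incl_G2 (g k.+2, g k.+3)) (eta, eta, 0).
  by split; rewrite /=; [exact: erefl|rewrite teta tmap0].
(* The middle covector is evaluated on (xi, xi, eta) = (xi, 0, 0) + (0, xi, eta). The sum is known
   from [in_Sigma]; [e1] carries the first summand to the preceding covector and [e2] the second to
   the following one. *)
have := covectorD c1 t1 t2.
have -> : (xi, 0, 0) + (0, xi, eta) = ((xi, xi, eta) : E * E * E).
  by congr (_, _, _); [exact: addr0|exact: add0r|exact: add0r].
have := covectorN c1 t1; have := covectorN c2 t3.
have -> : - ((xi, 0, 0) : E * E * E) = (- xi, 0, 0) by congr (_, _, _);
  exact: oppr0.
have -> : - ((eta, eta, 0) : E * E * E) = (- eta, - eta, 0) by congr (_, _, _);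
  exact: oppr0.
rewrite -e1 -e2 S0 S1 S2; lra.
Qed.

(** Every covector built here restricts to dL since the phi term vanishes on (v, v, w); only the
    matching conditions need the equations. *)
Lemma EL_dynamics :
  (forall k, (2 <= k <= N - 2)%N ->
      forall a, algebroid (tgt G (g k)) a ->
        0 = D1 (Le k) (g k) (g k.+1) (tleft setT G (g k) a)
            + D2 (Le k.-1) (g k.-1) (g k) (tleft setT G (g k) a)
            + (D1 (Le k.+1) (g k.+1) (g k.+2) (tright_inv setT G (g k.+1) a)
               + D2 (Le k) (g k) (g k.+1) (tright_inv setT G (g k.+1) a))) ->
  exists gam, second_order_dynamics L N g gam.
Proof.
move=> EL; have [f fS] := tleft_inverse (g 1%N).
pose eta w := tright_inv setT G (g 2) (tmap f (g 1%N) w).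
(* The case [k = 1] solves [key] for phi, with [f] recovering [a]. For [N <= 2] it involves values
   out of range, but then there is no matching condition. *)
pose phi k (w : E) : R := if k == 1%N then
    D1 (Le 1%N) (g 1%N) (g 2) w + D2 (Le 1%N) (g 1%N) (g 2) (eta w)
    + D1 (Le 2) (g 2) (g 3) (eta w)
  else - D2 (Le k.-1) (g k.-1) (g k) w.
have phi_lin k c u v : phi k (c *: u + v) = c * phi k u + phi k v.
  rewrite /phi; case: eqP => _; last by rewrite D2_linear opprD mulrN.
  rewrite /eta tmapD tmapZ tright_linear !D1_linear !D2_linear; ring.
have phi0 k : phi k 0 = 0.
  by have := phi_lin k 1 0 0; rewrite scale1r addr0 mul1r; lra.
have phiN k w : phi k (- w) = - phi k w.
  by have := phi_lin k (-1) w 0; rewrite scaleN1r addr0 phi0; lra.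
exists (fun k u => D1 (Le k) (g k) (g k.+1) u.1.2 + D2 (Le k) (g k) (g k.+1) u.2
  + phi k (u.1.1 - u.1.2)); split=> [k kN|k kN X Y sXY].
  split=> [c u v _ _|u tu].
    rewrite /= D1_linear D2_linear.
    have -> : c *: u.1.1 + v.1.1 - (c *: u.1.2 + v.1.2) =
        c *: (u.1.1 - u.1.2) + (v.1.1 - v.1.2).
      by rewrite scalerBr opprD addrACA.
    rewrite phi_lin; ring.
  rewrite tmap_incl_G2 /= subrr phi0 addr0 -D12E -surjective_pairing.
  by apply/esym; apply: tmap_along_G2 (LeL kN) => //; exact: G2g.
case: k kN => [//|k] kN; have K0 : (1 <= k < N)%N by lia.
have K1 : (1 <= k.+1 < N)%N by lia.
have P0 : prolongation (g k, g k, g k.+1) by split=> //=; exact: tg.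
have P1 : prolongation (g k.+1, g k.+1, g k.+2) by split=> //=; exact: tg.
rewrite -[k.+1.-1]/k (prol_lfieldE sXY P0) (prol_rfieldE sXY P1) /=.
have aX : algebroid (tgt G (g k)) (X (tgt G (g k))) by case: sXY => -[_ aX] _ _.
rewrite /lfield /left_field /rfield /right_field -tg//.
set a := X _ in aX *.
(* Matching at index [k.+1] amounts to this identity. It holds by construction for [k = 1] and is
   the equation at [k] otherwise. *)
have key : phi k (tleft setT G (g k) a) =
    D1 (Le k) (g k) (g k.+1) (tleft setT G (g k) a)
    + D2 (Le k) (g k) (g k.+1) (tright_inv setT G (g k.+1) a)
    + D1 (Le k.+1) (g k.+1) (g k.+2) (tright_inv setT G (g k.+1) a).
  rewrite /phi; case: eqP => k1; first by subst k; rewrite /eta fS.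
  have kN' : (2 <= k <= N - 2)%N by lia.
  move: (EL k kN' _ aX); set xi := tleft _ _ _ _; set et := tright_inv _ _ _ _.
  clearbody xi et; lra.
move: key; set xi := tleft _ _ _ _; set et := tright_inv _ _ _ _; set y := Y _.
clearbody xi et y => key.
(* This sign makes the contribution of [y] equal on both sides, so that no condition on Y
   remains. *)
have phik w : phi k.+1 w = - D2 (Le k) (g k) (g k.+1) w.
  by rewrite /phi; case: eqP => // -[k0]; move: K0; rewrite k0.
have d2y : D2 (Le k) (g k) (g k.+1) (- y + et) =
    - D2 (Le k) (g k) (g k.+1) y + D2 (Le k) (g k) (g k.+1) et.
  by rewrite -scaleN1r D2_linear mulN1r.
have d20 : D2 (Le k.+1) (g k.+1) (g k.+2) 0 = 0 by exact: D20.
have d1e : D1 (Le k.+1) (g k.+1) (g k.+2) (- et) = - D1 (Le k.+1) (g k.+1)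
  (g k.+2) et.
  by rewrite -[- et]addr0 -scaleN1r D1_linear mulN1r D10 addr0.
rewrite sub0r phiN key opprK phik d2y d20 d1e; lra.
Qed.

End EulerLagrange.

(** Eliminating the covectors is expressed by the existence of [gam]. The equivalence holds for
    every choice of local extensions [Le], although the dynamics never mentions them. For [N < 2]
    the truncated [N - 2] leaves an empty range of equations. *)
Theorem theorem4p6 (R : realType) (n m : nat) (G : lie_groupoid R n m)
    (L : prod_space (arrows G) (arrows G) -> R^o)
    (hL : discrete_lagrangian L) :
  (forall (X : base G -> 'rV[R]_n) (Y : arrows G -> 'rV[R]_n),
    is_prol_section X Y ->
    forall g h r : arrows G, prolongation (g, h, r) ->
      prol_lfield X Y (g, h, r) = (0, lfield X h, Y r) /\
      prol_rfield X Y (g, h, r) = (- Y g, rfield X h, 0)) /\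
  (forall (N : nat) (g : nat -> arrows G),
    (forall k, (1 <= k < N)%N -> G2 (g k, g k.+1)) ->
    forall Le : nat -> prod_space (arrows G) (arrows G) -> R^o,
    (forall k, (1 <= k < N)%N ->
      local_extension (N := flat_space R^o) (@G2 R n m G) L
        (g k, g k.+1) (Le k)) ->
    (exists gam, second_order_dynamics L N g gam) <->
    (forall k, (2 <= k <= N - 2)%N ->
      forall a, algebroid (tgt G (g k)) a ->
        0 = D1 (Le k) (g k) (g k.+1) (tleft setT G (g k) a)
            + D2 (Le k.-1) (g k.-1) (g k) (tleft setT G (g k) a)
            + (D1 (Le k.+1) (g k.+1) (g k.+2) (tright_inv setT G (g k.+1) a)
               + D2 (Le k) (g k) (g k.+1) (tright_inv setT G (g k.+1) a)))).
Proof.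
split=> [X Y sXY g h r ghr|N g G2g Le LeL].
  by split; [exact: prol_lfieldE|exact: prol_rfieldE].
split=> [[gam dyn] [//|k] kN a aa|]; last exact: EL_dynamics.
by apply: (dynamics_EL G2g LeL dyn _ _ aa); lia.
Qed.
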